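(* Let $n\ge 3$ be an integer. (i) Let $a_1,\ldots,a_{n-1}$ be positive integers. Then $M_n(a_1,\ldots,a_{n-1},1)=\pm T$ if and only if $(a_1,\ldots,a_{n-1})$ is the quiddity of a notched $3d$-dissection of a convex polygon with $n$ vertices. (ii) Let $a_1,\ldots,a_n$ be positive integers with $a_n\ge 2$. Then $M_n(a_1,\ldots,a_n)=\pm T$ if and only if $(a_1,\ldots,a_n)$ is the quiddity of a capped $3d$-dissection of a convex polygon with $n+2$ vertices. Here $M_n(\cdot)=\pm T$ means $M_n(\cdot)\in\{T,-T\}$.
   Context: For integers $a_1,\ldots,a_n$ put $$M_n(a_1,\ldots,a_n)=\begin{pmatrix} a_n & -1\\ 1 & 0\end{pmatrix}\begin{pmatrix} a_{n-1} & -1\\ 1 & 0\end{pmatrix}\cdots\begin{pmatrix} a_1 & -1\\ 1 & 0\end{pmatrix}\in SL_2(\mathbb{Z}),\qquad T=\begin{pmatrix} 1 & 1\\ 0 & 1\end{pmatrix}.$$ Notched $3d$-dissection (French: 3$d$-dissection échancrée). Let $m\ge 5$ and let $P$ be a convex polygon with $m+1$ vertices. A notched $3d$-dissection of $P$ is a decomposition of $P$ into sub-polygons by diagonals of $P$ that cross only at vertices of $P$, such that: (1) exactly one of the sub-polygons is a quadrilateral; (2) every other sub-polygon of the decomposition has a number of vertices that is a multiple of $3$; (3) the quadrilateral has exactly two of its sides that are sides of $P$, and these two sides have a vertex in common. This common vertex is numbered $0$, and the other vertices of $P$ are then numbered $1,2,\ldots,m$ in counterclockwise order. For $1\le i\le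 m$, let $a_i$ be the number of sub-polygons whose number of vertices is a multiple of $3$ and which have vertex $i$ as one of their vertices. The sequence $(a_1,\ldots,a_m)$ is the quiddity of the notched $3d$-dissection. (For $m<5$ there are no notched $3d$-dissections of a polygon with $m+1$ vertices.) Capped $3d$-dissection (French: 3$d$-dissection coiffée). Let $n\ge 3$ and let $P$ be a convex polygon with $n+2$ vertices. A capped $3d$-dissection of $P$ is a decomposition of $P$ into sub-polygons by diagonals of $P$ that cross only at vertices of $P$, such that: (1) every sub-polygon of the decomposition has a number of vertices that is a multiple of $3$; (2) $P$ has an exterior triangle $\Delta$ (a triangle of the decomposition two of whose sides are sides of $P$) to which the weight $-1$ is assigned; (3) all the other sub-polygons receive the weight $1$; (4) the triangle $\Delta$ of weight $-1$ has a side in common with a triangle $\Delta'$ of weight $1$, and one of the sides of $\Delta'$ is a side of $P$. The vertex belonging only to $\Delta$ is numbered $0$, and the vertex belonging only to $\Delta$ and $\Delta'$ is numbered $-1$. The other vertices are numbered $1,\ldots,n$ consecutively around $P$ so that the vertex numbered $n$ is adjacent to the vertex numbered $-1$ (so the vertices of $P$ in cyclic order are $-1,0,1,2,\ldots,n$). For $1\le i\le n$, let $a_i$ be the sum of the weights of the sub-polygons having vertex $i$ as one of their vertices. The sequence $(a_1,\ldots,a_n)$ is the quiddity of the capped $3d$-dissection. *)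

(* Defs.v *)
From HB Require Import structures.
From mathcomp Require Import all_boot all_order all_algebra.

Set Implicit Arguments.
Unset Strict Implicit.
Unset Printing Implicit Defensive.

Import Order.TTheory GRing.Theory Num.Theory.
Local Open Scope ring_scope.

Definition mx2 (a b c d : int) : 'M[int]_2 :=
  \matrix_(i, j) if i == 0 then (if j == 0 then a else b)
                 else (if j == 0 then c else d).

(* M [:: a_1; ...; a_n] is the product of the mx2 a_i (-1) 1 0 taken from
   a_n (leftmost factor) down to a_1 (rightmost factor). *)
Definition M (s : seq int) : 'M[int]_2 := \prod_(x <- rev s) mx2 x (-1) 1 0.

Definition T : 'M[int]_2 := mx2 1 1 0 1.

(* The vertices of a convex N-gon are the elements of 'I_N, listed in
   counterclockwise order; a convex polygon inscribed in it is identified with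
   its set of vertices, and a segment between two vertices with the pair of
   its endpoints. *)

(* Going counterclockwise from u, one meets w strictly before v. *)
Definition ccw (N : nat) (u w v : 'I_N) : bool :=
  [|| u < w < v, w < v < u | v < u < w]%N.

Definition sides (N : nat) (F : {set 'I_N}) : {set {set 'I_N}} :=
  [set [set u; v] | u in F, v in F
                  & (u != v) && [forall w in F, ~~ ccw u w v]].

Definition diagonals (N : nat) (F : {set 'I_N}) : {set {set 'I_N}} :=
  [set [set u; v] | u in F, v in F & u != v] :\: sides F.

(* The segments d and e meet in a point interior to both: the endpoints of e
   lie strictly on either side of d. *)
Definition crosses (N : nat) (d e : {set 'I_N}) : bool :=
  [exists u in d, exists v in d, exists x in e, exists y in e,
    ccw u x v && ccw v y u].

Definition dissection (N : nat) (D : {set {set 'I_N}}) : Prop :=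
  D \subset diagonals [set: 'I_N] /\
  forall d e, d \in D -> e \in D -> ~~ crosses d e.

(* The pieces cut out by the diagonals of D: the polygons bounded by sides of
   the N-gon and members of D that no member of D cuts further.  As members of
   D do not cross, one that meets the interior of such a polygon has to be one
   of its diagonals. *)
Definition subpolygons (N : nat) (D : {set {set 'I_N}}) : {set {set 'I_N}} :=
  [set F : {set 'I_N} | [&& (2 < #|F|)%N,
     sides F \subset sides [set: 'I_N] :|: D & [disjoint diagonals F & D]]].

(* Notched 3d-dissection of a polygon with m.+1 vertices, with quadrilateral Q;
   the vertex numbered i is the ordinal of value i. *)
Record notched_dissection (m : nat) (D : {set {set 'I_m.+1}})
    (Q : {set 'I_m.+1}) : Prop := NotchedDissection {
  notched_size : (5 <= m)%N;
  notched_dissect : dissection D;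
  notched_quad : [set F in subpolygons D | #|F| == 4%N] = [set Q];
  notched_other :
    forall F, F \in subpolygons D -> F != Q -> (3 %| #|F|)%N;
  notched_sides : #|sides Q :&: sides [set: 'I_m.+1]| = 2%N;
  notched_vertex0 :
    forall e, e \in sides Q :&: sides [set: 'I_m.+1] -> ord0 \in e
}.

(* Index i : 'I_m stands for the vertex numbered i + 1. *)
Definition notched_quiddity (m : nat) (D : {set {set 'I_m.+1}}) : m.-tuple int :=
  [tuple #|[set F in subpolygons D | (3 %| #|F|)%N & lift ord0 i \in F]|%:Z
     | i < m].

Definition is_notched_quiddity (m : nat) (a : m.-tuple int) : Prop :=
  exists (D : {set {set 'I_m.+1}}) (Q : {set 'I_m.+1}),
    notched_dissection D Q /\ a = notched_quiddity D.

(* Capped 3d-dissection of a polygon with n.+2 vertices, with triangle Delta of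
   weight -1 and adjacent triangle Delta'.  The vertex numbered i, 0 <= i <= n,
   is the ordinal of value i; the vertex numbered -1 is ord_max, of value
   n.+1, which sits between n and 0 in the cyclic order. *)
Record capped_dissection (n : nat) (D : {set {set 'I_n.+2}})
    (Delta Delta' : {set 'I_n.+2}) : Prop := CappedDissection {
  capped_size : (3 <= n)%N;
  capped_dissect : dissection D;
  capped_3d : forall F, F \in subpolygons D -> (3 %| #|F|)%N;
  capped_Delta : Delta \in subpolygons D;
  capped_Delta_triangle : #|Delta| = 3%N;
  capped_Delta_exterior : #|sides Delta :&: sides [set: 'I_n.+2]| = 2%N;
  capped_Delta' : Delta' \in subpolygons D;
  capped_Delta'_triangle : #|Delta'| = 3%N;
  capped_neq : Delta' != Delta;
  capped_adjacent : sides Delta :&: sides Delta' != set0;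
  capped_Delta'_side : sides Delta' :&: sides [set: 'I_n.+2] != set0;
  capped_vertex0 : [set F in subpolygons D | ord0 \in F] = [set Delta];
  capped_vertexN1 :
    [set F in subpolygons D | ord_max \in F] = [set Delta; Delta']
}.

Definition capped_weight (n : nat) (Delta F : {set 'I_n.+2}) : int :=
  if F == Delta then -1 else 1.

(* Index i : 'I_n stands for the vertex numbered i + 1. *)
Definition capped_quiddity (n : nat) (D : {set {set 'I_n.+2}})
    (Delta : {set 'I_n.+2}) : n.-tuple int :=
  [tuple \sum_(F in subpolygons D | inord i.+1 \in F) capped_weight Delta F
     | i < n].

Definition is_capped_quiddity (n : nat) (a : n.-tuple int) : Prop :=
  exists (D : {set {set 'I_n.+2}}) (Delta Delta' : {set 'I_n.+2}),
    capped_dissection D Delta Delta' /\ a = capped_quiddity D Delta.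

(* Main.v *)
Require Import Defs.
From HB Require Import structures.
From mathcomp Require Import all_boot all_order all_algebra.
From mathcomp Require Import zify ring.
Import Order.TTheory GRing.Theory Num.Theory.

(** Put J = M(0), so that the factor of an entry a is T^a J.  Around a dissected
    polygon each vertex contributes a power of T, with exponent the number of
    pieces at the vertex, and each side contributes J.  Since (T J)^3 = -1, a
    piece whose number of vertices is a multiple of 3 may be replaced by its
    base side at the cost of a sign, so the word of a 3d-dissection collapses.

    Conversely, the continuants of entries >= 2 grow strictly, so a positive
    solution of M = 1, or of M = J, up to sign has away from its ends either an
    entry 1 between two entries >= 2 or two adjacent entries 1, apart from
    (1,1,1) and (1,1,2,1,1).  As M(a+1,1,b+1) = M(a,b) and
    M(a,1,1,b) = - M(a+b-1), one can shorten the solution; on dissections the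
    first move removes an exterior triangle, and the second one removes three
    vertices from a piece.

    Finally M(a_1,...,a_{n-1},1) = T up to sign means M(a_1,...,a_{n-1}) = J up
    to sign, and this is solved by two 3d-dissected polygons with a common
    vertex, the sides 1k and km of the quadrilateral; M(a_1,...,a_n) = T up to
    sign means that decreasing a_n by one gives a solution of M = 1 up to sign,
    that is one 3d-dissected polygon, on whose side 1n the two triangles of a
    capped dissection are glued. *)

Set Implicit Arguments.
Unset Strict Implicit.
Unset Printing Implicit Defensive.

(** * Dissections as plane forests *)

(* A row of dissected polygons glued end to end on an interval of vertices,
   read from left to right: [Fside f] starts with a bare side, and
   [Fpiece c f] with a polygon whose piece at the base has its remaining sides,
   from left to right, carried by [c]. *)
Inductive forest : Type :=
| Fnil
| Fside of forest
| Fpiece of forest & forest.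

Fixpoint len f :=
  match f with
  | Fnil => 0
  | Fside f => (len f).+1
  | Fpiece c f => len c + len f
  end.

Fixpoint rank f :=
  match f with
  | Fnil => 0
  | Fside f => (rank f).+1
  | Fpiece c f => (rank f).+1
  end.

Fixpoint is_3d f :=
  match f with
  | Fnil => true
  | Fside f => is_3d f
  | Fpiece c f => [&& 3 %| (rank c).+1, is_3d c & is_3d f]
  end.

(* The number of pieces at the i-th vertex; a vertex shared by two consecutive
   members of the row, or at an end of it, counts [e] more, so that [e = 1] takes
   the piece enclosing the row into account. *)
Fixpoint quid e f i :=
  match f with
  | Fnil => e * (i == 0)
  | Fside f => e * (i == 0) + (if i is j.+1 then quid e f j else 0)
  | Fpiece c f =>
      e * (i == 0) + quid 1 c i + (if len c <= i then quid e f (i - len c) else 0)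
  end.

Lemma quid_out e f i : len f < i -> quid e f i = 0.
Proof.
elim: f e i => [|f IH|c IHc f IHf] e [|i] //= h; rewrite muln0 //; first exact: IH.
by rewrite IHc ?IHf; [case: ifP|lia|lia].
Qed.

Lemma dvd3_rank c : 3 %| (rank c).+1 -> 1 < rank c.
Proof. by case: (rank c) => [|[|k]]. Qed.

Lemma rank_le_len f : is_3d f -> rank f <= len f.
Proof.
elim: f => [|f IH|c IHc f IHf] //=.
by case/and3P => /dvd3_rank h /IHc hc /IHf hf; lia.
Qed.

(** Undoes the reduction of [a+1, 1, b+1] to [a, b]. The p-th side of the outer boundary is a bare
    side somewhere in the forest; a triangle glued on it takes its place in the same row, so no rank
    changes. *)
Lemma ear_insertion f e p : is_3d f -> p < len f ->
  exists2 f', [/\ is_3d f', len f' = (len f).+1 & rank f' = rank f] &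
    forall i : nat, quid e f' i =
      if i <= p then quid e f i + (i == p)
      else if i == p.+1 then 1 else quid e f i.-1 + (i == p.+2).
Proof.
elim: f e p => [|f IH|c IHc f IHf] e p //=.
  move=> okf; case: p => [_|p hp].
    (* The first bare side becomes the base of a triangle. *)
    exists (Fpiece (Fside (Fside Fnil)) f) => //= i.
    by case: i => [|[|[|i]]] //=; rewrite ?subn2 /=; lia.
  have [//|f' [ok' len' rk'] q'] := IH e p okf.
  exists (Fside f'); first by rewrite /= ok' len' rk'.
  move=> [|i] /=; first by lia.
  rewrite q' ltnS; case: i => [|i] /=; rewrite ?eqSS muln0 ?add0n; lia.
case/and3P => h3 okc okf hp; have := dvd3_rank h3; have := rank_le_len okc => lc rc.
have [lt_pc|le_cp] := ltnP p (len c).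
  have [//|c' [ok' len' rk'] q'] := IHc 1 p okc.
  exists (Fpiece c' f); first by split; rewrite /= ?ok' ?len' ?rk' ?h3 ?okf.
  move=> i /=; rewrite q' len'.
  have [le_ip|lt_pi] := leqP i p; first by rewrite !ifF; lia.
  have [->|ne] := eqVneq i p.+1.
    rewrite ifF; lia.
  case: i lt_pi ne => // i lt_pi ne /=; rewrite subSS.
  by case: ifP => h; lia.
have [|f' [ok' len' rk'] q'] := IHf e (p - len c) okf; first by lia.
exists (Fpiece c f'); first by split; rewrite /= ?ok' ?len' ?rk' ?h3 ?okc //; lia.
move=> i /=; rewrite q'.
have [le_ip|lt_pi] := leqP i p.
  rewrite leq_sub2r //; have [h|h] := leqP (len c) i; last by lia.
  have -> : (i - len c == p - len c) = (i == p) by lia.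
  by lia.
have h : len c <= i by lia.
rewrite h; have -> : (i - len c <= p - len c) = false by lia.
have -> : (i - len c == (p - len c).+1) = (i == p.+1) by lia.
have -> : (i - len c == (p - len c).+2) = (i == p.+2) by lia.
rewrite (@quid_out 1 c i); last by lia.
have [->|ne] := eqVneq i p.+1; first by lia.
case: i lt_pi ne h => // i lt_pi ne h /=.
have -> : len c <= i by lia.
rewrite (_ : (i.+1 - len c).-1 = i - len c); last lia.
by rewrite (@quid_out 1 c i); lia.
Qed.

(** Describes the inverse of the reduction of [a, 1, 1, b] to the single entry [a + b - 1] at
    position [p]. *)
Definition inserts3 p a b (g g' : nat -> nat) :=
  [/\ forall i, i < p -> g' i = g i, [/\ g' p = a, g' p.+1 = 1, g' p.+2 = 1 & g' p.+3 = b]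
    & forall i, p < i -> g' i.+3 = g i].

(* The a-th piece at the vertex p, counted from the left, receives three new
   vertices; this increases the rank when it is the enclosing piece. *)
Lemma triple_insertion f e p a b : is_3d f -> e <= 1 -> 0 < a -> 0 < b ->
    p <= len f -> (quid e f p).+1 = a + b ->
  exists2 f', [/\ is_3d f', len f' = (len f).+3 &
                  rank f' = rank f \/ e = 1 /\ rank f' = (rank f).+3] &
    inserts3 p a b (quid e f) (quid e f').
Proof.
move=> + e1; elim: f e p a b e1 => [|f IH|c IHc f IHf] e p a b e1 /=.
- move=> _ a0 b0; rewrite leqn0 => /eqP -> /=; rewrite muln1 => eab.
  have -> : e = 1 by lia.
  have [-> ->] : a = 1 /\ b = 1 by lia.
  exists (Fside (Fside (Fside Fnil))); first by split=> //; right; split => //; lia.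
  by split => [//||[]].
- move=> okf a0 b0; case: p => [_|p hp] /=; rewrite ?muln1 ?muln0 ?addn0 ?add0n => eab.
    exists (Fside (Fside (Fside (Fside f)))); first by split=> //=; right; split; lia.
    have -> : e = 1 by lia.
    have [-> ->] : a = 1 /\ b = 1 by lia.
    by split => [//||[]//] /=; rewrite ?mul1n ?addn0.
  have [|f' [ok' len' rk'] [lo [q0 q1 q2 q3] hi]] := IH e p a b e1 okf a0 b0 hp; first by lia.
  exists (Fside f'); first by split => //=; lia.
  split => [[|i]||[|i]] //=; first by rewrite ltnS => /lo ->.
    by rewrite !muln0 q0 q1 q2 q3.
  by rewrite ltnS => /hi ->.
case/and3P=> h3 okc okf a0 b0 hp; have := dvd3_rank h3; have := rank_le_len okc => lc rc eab.
have ok_ins c' : is_3d c' -> rank c' = rank c \/ 1 = 1 /\ rank c' = (rank c).+3 ->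
    is_3d (Fpiece c' f).
  by move=> ok' /= rk'; rewrite ok' okf /= andbT; case: rk' => [->|[_ ->]] //;
    rewrite -[_.+4]addn3 dvdn_addl.
have [lt_pc|le_cp] := ltnP p (len c).
  (* At vertex 0 the enclosing piece, if counted, comes first. When it is the one to enlarge, three
     bare sides are put in front of the row. *)
  have [/andP[p0 /eqP ae1]|h0] := boolP ((p == 0) && (a == e)).
    move: eab; rewrite (eqP p0) ifF; last by lia.
    rewrite ae1 muln1 addn0 => eab; have e_1 : e = 1 by lia.
    rewrite e_1 in eab *; exists (Fside (Fside (Fside (Fpiece c f)))).
      by split=> //=; [rewrite h3 okc|right; split; lia].
    split => [//||[|i] //] /=; split=> //; rewrite ifF; lia.
  move: eab; rewrite [len c <= p]leqNgt lt_pc /= => eab.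
  (* In the other case the piece to enlarge lies in [c], and [z] counts the enclosing piece met
     before it. *)
  have ze : e * (p == 0) < a by case: eqP h0 => _; lia.
  have [z zE] : {z | z = e * (p == 0)} by exists (e * (p == 0)).
  rewrite -zE in eab ze.
  have eab1 : (quid 1 c p).+1 = a - z + b by clear -eab ze; lia.
  have [||c' [ok' len' rk'] [lo [q0 q1 q2 q3] hi]] := IHc 1 p (a - z) b isT okc _ b0 _ eab1;
    [lia..|].
  exists (Fpiece c' f); first by split; [exact: ok_ins|rewrite /= len'; lia|left].
  split.
  - by move=> i lt_ip /=; rewrite lo // !ifF; lia.
  - by rewrite /= len' q0 q1 q2 q3 -zE !muln0 !add0n !ifF; [split; lia|lia..].
  by move=> i lt_pi /=; rewrite hi // len' !ltnS subSS; case: i lt_pi => // i lt_pi; lia.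
move: eab; rewrite le_cp => eab.
(* At the junction of [c] and [f] the pieces of [c] come first. If the a-th piece is one of them it
   is enlarged at the last vertex of [c]; otherwise, or if [p] is beyond the junction, the insertion
   takes place in [f]. *)
have [/andP[/eqP pc le_a]|h0] := boolP ((p == len c) && (a <= quid 1 c p)).
  subst p; rewrite subnn in eab.
  have lc0 : (len c == 0) = false by lia.
  rewrite lc0 muln0 in eab.
  have [|||c' [ok' len' rk'] [lo [q0 q1 q2 q3] hi]] :=
      IHc 1 (len c) a ((quid 1 c (len c)).+1 - a) isT okc a0; [lia..|].
  exists (Fpiece c' f); first by split; [exact: ok_ins|rewrite /= len'; lia|left].
  split.
  - by move=> i lt_ip /=; rewrite lo // !ifF; lia.
  - rewrite /= len' q0 q1 q2 q3 lc0 leqnn subnn !muln0 !ifF; [|lia..].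
    by split; lia.
  by move=> i lt_pi /=; rewrite hi // len' !ltnS !subSS; case: i lt_pi => // i lt_pi; lia.
have p0 : (p == 0) = false by lia.
rewrite p0 muln0 in eab.
have lt_a : quid 1 c p < a.
  have [pc|pc] := eqVneq p (len c); first by move: h0; rewrite pc eqxx -ltnNge.
  by rewrite quid_out //; lia.
have eab1 : (quid e f (p - len c)).+1 = a - quid 1 c p + b by clear -eab lt_a; lia.
have [||f' [ok' len' rk'] [lo [q0 q1 q2 q3] hi]] :=
    IHf e (p - len c) (a - quid 1 c p) b e1 okf _ b0 _ eab1; [lia..|].
exists (Fpiece c f'); first by split; rewrite /= ?h3 ?okc //; lia.
split.
- by move=> i lt_ip /=; case: ifP => // h; rewrite lo //; lia.
- rewrite /= (@quid_out 1 c p.+1) ?(@quid_out 1 c p.+2) ?(@quid_out 1 c p.+3); [|lia..].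
  rewrite !ifT; [|lia..]; rewrite !subSn ?q0 ?q1 ?q2 ?q3 ?p0; [|lia..].
  split; lia.
move=> i lt_pi /=; rewrite !(@quid_out 1 c); [|lia..].
by rewrite !ifT; [|lia..]; rewrite !subSn ?hi; lia.
Qed.

(** * Sub-polygons in terms of the order of the vertices *)

Section Polygon.
Variable N : nat.
Implicit Types (x y u v w : 'I_N) (F e : {set 'I_N}) (D : {set {set 'I_N}}).

Lemma set2_lt x y u v : x < y -> [set x; y] = [set u; v] ->
  u = x /\ v = y \/ u = y /\ v = x.
Proof.
move=> lt_xy E.
have: u \in [set x; y] by rewrite E set21.
have: v \in [set x; y] by rewrite E set22.
have: x \in [set u; v] by rewrite -E set21.
have: y \in [set u; v] by rewrite -E set22.
case/set2P => ->; case/set2P => ?; case/set2P => ?; case/set2P => ?; subst; auto.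
all: by rewrite ltnn in lt_xy.
Qed.

(** Of the two arcs with ends [x] and [y], one has no vertex of [F] strictly inside; the alternative
    tells which. *)
Lemma sidesP F x y : x < y ->
  reflect [/\ x \in F, y \in F & (forall w, w \in F -> ~~ (x < w < y)) \/
                               (forall w, w \in F -> x <= w <= y)]
          ([set x; y] \in sides F).
Proof.
move=> lt_xy; apply: (iffP imset2P) => [[u v uF]|[xF yF H]].
  rewrite inE => /and3P[vF _ /forall_inP H] /(set2_lt lt_xy)[] [? ?]; subst; split=> //.
    by left=> w /H; rewrite /ccw; apply: contra => ->.
  by right=> w /H; rewrite /ccw; lia.
case: H => H; [exists x y|exists y x] => //; rewrite ?inE ?xF ?yF /= 1?setUC //.
  by rewrite neq_ltn lt_xy; apply/forall_inP => w /H; rewrite /ccw; lia.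
by rewrite neq_ltn lt_xy orbT; apply/forall_inP => w /H; rewrite /ccw; lia.
Qed.

Lemma sides_pair F e : e \in sides F -> exists x y, x < y /\ e = [set x; y].
Proof.
case/imset2P => u v _; rewrite inE => /and3P[_ uv _] ->.
by move: uv; rewrite neq_ltn => /orP[h|h]; [exists u, v|exists v, u; rewrite setUC].
Qed.

Lemma diagonals_pair F e : e \in diagonals F -> exists x y, x < y /\ e = [set x; y].
Proof.
rewrite inE => /andP[_] /imset2P[u v _]; rewrite inE => /andP[_ uv] ->.
by move: uv; rewrite neq_ltn => /orP[h|h]; [exists u, v|exists v, u; rewrite setUC].
Qed.

Lemma diagonalsP F x y : x < y ->
  reflect [/\ x \in F, y \in F, (exists2 w, w \in F & x < w < y) &
                               (exists2 w, w \in F & ~~ (x <= w <= y))]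
          ([set x; y] \in diagonals F).
Proof.
move=> lt_xy; rewrite inE;
  apply: (iffP andP) => [[/(sidesP _ lt_xy) H]|[xF yF [w wF wi] [w' w'F wo]]].
  case/imset2P => u v uF; rewrite inE => /andP[vF _] E.
  have [xF yF] : x \in F /\ y \in F by case: (set2_lt lt_xy E) => -[<- <-].
  split=> //.
    case: (pickP [pred w in F | x < w < y]) => [w /andP[wF wb]|none]; first by exists w.
    by case: H; split=> //; left=> w wF; have := none w; rewrite inE /= wF /= => ->.
  case: (pickP [pred w in F | ~~ (x <= w <= y)]) => [w /andP[wF wb]|none]; first by exists w.
  by case: H; split=> //; right=> w wF; have := none w; rewrite inE /= wF /= => /negbFE.
split.
  apply/(sidesP _ lt_xy) => -[_ _ [/(_ w wF)|/(_ w' w'F)]]; first by rewrite wi.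
  by apply/negP.
by apply/imset2P; exists x y; rewrite ?inE ?yF ?neq_ltn ?lt_xy.
Qed.

Lemma crossesE x y u v : x < y -> u < v ->
  crosses [set x; y] [set u; v] = (x < u < y) && (y < v) || (u < x < v) && (v < y).
Proof.
move=> lt_xy lt_uv; apply/idP/idP.
  case/exists_inP=> a /set2P aE /exists_inP[b /set2P bE].
  case/exists_inP=> c /set2P cE /exists_inP[d /set2P dE].
  by rewrite /ccw; case: aE => ->; case: bE => ->; case: cE => ->; case: dE => ->; lia.
move=> H; apply/exists_inP; exists x; rewrite ?set21 //; apply/exists_inP; exists y;
  rewrite ?set22 //.
case/orP: H => H.
  apply/exists_inP; exists u; rewrite ?set21 //; apply/exists_inP; exists v; rewrite ?set22 //.
  by rewrite /ccw; lia.
apply/exists_inP; exists v; rewrite ?set22 //; apply/exists_inP; exists u; rewrite ?set21 //.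
by rewrite /ccw; lia.
Qed.

Lemma sides_setT x y : x < y ->
  ([set x; y] \in sides [set: 'I_N]) = (y == x.+1 :> nat) || (x == 0 :> nat) && (y == N.-1 :> nat).
Proof.
move=> lt_xy; apply/(sidesP _ lt_xy)/idP => [[_ _ []] H|H].
- have lt : x.+1 < N by have := ltn_ord y; lia.
  by have := H (Ordinal lt) (in_setT _); rewrite /=; lia.
- have lt : N.-1 < N by have := ltn_ord y; lia.
  have lt0 : 0 < N by lia.
  have := H (Ordinal lt) (in_setT _); have := H (Ordinal lt0) (in_setT _).
  by rewrite /=; have := ltn_ord y; lia.
split; rewrite ?in_setT //; case/orP: H => H; [left|right] => w _; first by lia.
by have := ltn_ord w; lia.
Qed.

(* Vertices are compared with the positions in a forest, which are natural
   numbers; hence [joins] and [edge] on [nat]. *)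
Definition joins D (i j : nat) :=
  [exists x : 'I_N, exists y : 'I_N, [&& x == i :> nat, y == j :> nat & [set x; y] \in D]].

Lemma joinsE D x y : joins D x y = ([set x; y] \in D).
Proof.
apply/existsP/idP => [[u /existsP[v /and3P[/eqP/val_inj-> /eqP/val_inj->]]] //|H].
by exists x; apply/existsP; exists y; rewrite !eqxx.
Qed.

Lemma joinsP D i j : joins D i j -> exists x y, [/\ i = x, j = y & [set x; y] \in D].
Proof. by case/existsP=> u /existsP[v /and3P[/eqP<- /eqP<-]]; exists u, v. Qed.

Definition edge D (i j : nat) :=
  [|| j == i.+1, (i == 0) && (j == N.-1) | joins D i j].

Lemma edgeE D x y : x < y -> ([set x; y] \in sides [set: 'I_N] :|: D) = edge D x y.
Proof. by move=> lt_xy; rewrite inE sides_setT // /edge -joinsE orbA. Qed.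

(** Separates the steps between consecutive vertices of [F] from the one closing side, which joins
    the least vertex to the greatest. *)
Lemma subpolygonP D F :
  reflect [/\ 2 < #|F|,
    forall x y, x \in F -> y \in F -> x < y ->
      (forall w, w \in F -> ~~ (x < w < y)) -> edge D x y,
    forall x y, x \in F -> y \in F -> x < y ->
      (forall w, w \in F -> x <= w <= y) -> edge D x y &
    forall x y z w, x \in F -> y \in F -> z \in F -> w \in F ->
      x < z < y -> ~~ (x <= w <= y) -> ~~ joins D x y]
   (F \in subpolygons D).
Proof.
rewrite inE; apply: (iffP and3P) => -[cF].
  move=> /subsetP sF dF; split=> // [x y xF yF xy H|x y xF yF xy H|x y z w xF yF zF wF xzy wo].
  - by rewrite -edgeE //; apply: sF; apply/sidesP => //; split=> //; left.
  - by rewrite -edgeE //; apply: sF; apply/sidesP => //; split=> //; right.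
  have xy : x < y by lia.
  rewrite joinsE; apply/negP => xyD.
  have /(disjointFr dF) : [set x; y] \in diagonals F.
    by apply/diagonalsP => //; split=> //; [exists z|exists w].
  by rewrite xyD.
move=> H1 H2 H3; split=> //.
  apply/subsetP => e eF; have [x [y [xy E]]] := sides_pair eF; subst e.
  by case/(sidesP _ xy): eF => xF yF [H|H]; rewrite edgeE //; auto.
apply/pred0P => e; apply/negbTE/andP => -[/= eF eD].
have [x [y [xy E]]] := diagonals_pair eF; subst e.
case/(diagonalsP _ xy): eF => xF yF [z zF zb] [w wF wo].
by have := H3 x y z w xF yF zF wF zb wo; rewrite joinsE eD.
Qed.

Lemma dissection_joins D : dissection D ->
  (forall i j, joins D i j -> i < j -> i.+1 < j < N /\ ~~ ((i == 0) && (j == N.-1))) /\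
  (forall i j k l, joins D i j -> joins D k l -> ~~ [&& i < k, k < j & j < l]).
Proof.
case=> /subsetP sD cD; split=> [i j /joinsP[x [y [-> -> /sD xyD]]] xy|i j k l].
  case/(diagonalsP _ xy): xyD => _ _ [w _ wb] [w' _ wo].
  by have := ltn_ord w'; have := ltn_ord y; lia.
move=> /joinsP[x [y [-> -> xyD]]] /joinsP[u [v [-> -> uvD]]].
by apply/negP => H; have := cD _ _ xyD uvD; rewrite crossesE; lia.
Qed.

Lemma joins_dissection D :
  (forall e, e \in D -> exists x y, x < y /\ e = [set x; y]) ->
  (forall i j, joins D i j -> i < j -> i.+1 < j < N /\ ~~ ((i == 0) && (j == N.-1))) ->
  (forall i j k l, i < j -> k < l -> joins D i j -> joins D k l -> ~~ [&& i < k, k < j & j < l]) ->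
  dissection D.
Proof.
move=> H1 H2 H3; split.
  apply/subsetP => e eD; have [x [y [xy E]]] := H1 e eD; subst e.
  have [/andP[h _] h'] := H2 x y (etrans (joinsE _ _ _) eD) xy.
  have lt1 : x.+1 < N by have := ltn_ord y; lia.
  have lt0 : 0 < N by lia.
  have lt2 : N.-1 < N by lia.
  apply/diagonalsP => //; split; rewrite ?in_setT //; first by exists (Ordinal lt1);
    rewrite ?in_setT //=; lia.
  have [x0|x0] := eqVneq (nat_of_ord x) 0; [exists (Ordinal lt2)|exists (Ordinal lt0)];
    rewrite ?in_setT //=; last by lia.
  by move: h'; rewrite x0 eqxx /=; have := ltn_ord y; lia.
move=> d e dD eD; have [x [y [xy E]]] := H1 d dD; have [u [v [uv E']]] := H1 e eD; subst.
rewrite -!joinsE in dD eD; rewrite crossesE // negb_or.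
by have := H3 _ _ _ _ xy uv dD eD; have := H3 _ _ _ _ uv xy eD dD; lia.
Qed.

Lemma max_below F (i : nat) x0 : x0 \in F -> x0 <= i ->
  exists p, [/\ p \in F, p <= i & forall w, w \in F -> w <= i -> w <= p].
Proof.
move=> x0F x0i; case: (@arg_maxnP _ x0 [pred x : 'I_N | (x \in F) && (x <= i)] (@nat_of_ord N)).
  by rewrite /= x0F.
by move=> p /andP[pF pi] H; exists p; split=> // w wF wi; apply: H; rewrite /= wF.
Qed.

Lemma min_above F (i : nat) x0 : x0 \in F -> i <= x0 ->
  exists p, [/\ p \in F, i <= p & forall w, w \in F -> i <= w -> p <= w].
Proof.
move=> x0F x0i; case: (@arg_minnP _ x0 [pred x : 'I_N | (x \in F) && (i <= x)] (@nat_of_ord N)).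
  by rewrite /= x0F.
by move=> p /andP[pF pi] H; exists p; split=> // w wF wi; apply: H; rewrite /= wF.
Qed.

End Polygon.

(** * Forests inside the polygon *)

(** Forests of arbitrary dissections: a piece has at least three vertices, with no condition modulo
    3. *)
Fixpoint wf f :=
  match f with
  | Fnil => true
  | Fside f => wf f
  | Fpiece c f => [&& 1 < rank c, wf c & wf f]
  end.

Lemma is_3d_wf f : is_3d f -> wf f.
Proof. by elim: f => //= c IHc f IHf /and3P[/dvd3_rank -> /IHc -> /IHf ->]. Qed.

Lemma wf_rank_le_len f : wf f -> rank f <= len f.
Proof. by elim: f => //= c IHc f IHf /and3P[h /IHc hc /IHf hf]; lia. Qed.

(** The vertices of the piece enclosing a row that starts at vertex [i]; those strictly inside a
    member are skipped. *)
Fixpoint top i f :=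
  match f with
  | Fnil => [:: i]
  | Fside f => i :: top i.+1 f
  | Fpiece c f => i :: top (i + len c) f
  end.

Lemma top_first i f : i \in top i f.
Proof. by case: f => *; rewrite inE ?eqxx. Qed.

Lemma top_last i f : i + len f \in top i f.
Proof.
elim: f i => [|f IH|c _ f IH] i /=; rewrite ?addn0 ?inE ?eqxx //.
  by rewrite addnS -addSn IH orbT.
by rewrite addnA IH orbT.
Qed.

Lemma top_bounds i f x : x \in top i f -> i <= x <= i + len f.
Proof.
elim: f i => [|f IH|c _ f IH] i /=; rewrite inE; first by lia.
  by case/orP => [|/IH]; lia.
by case/orP => [|/IH]; lia.
Qed.

Lemma size_top i f : size (top i f) = (rank f).+1.
Proof. by elim: f i => //= [f IH|c _ f IH] i; rewrite IH. Qed.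

Lemma top_uniq i f : wf f -> uniq (top i f).
Proof.
elim: f i => //= [f IH|c _ f IH] i.
  by move=> /IH ->; rewrite andbT; apply/negP => /top_bounds; lia.
case/and3P => h /wf_rank_le_len hc /IH ->; rewrite andbT.
by apply/negP => /top_bounds; lia.
Qed.

Section Polygon.
Variable N : nat.
Implicit Types (x y u v w : 'I_N) (F e : {set 'I_N}) (D : {set {set 'I_N}}).

Definition top_set i f : {set 'I_N} := [set x | nat_of_ord x \in top i f].

Lemma in_top_set i f x : (x \in top_set i f) = (nat_of_ord x \in top i f).
Proof. by rewrite inE. Qed.

Lemma card_top_set i f : wf f -> i + len f < N -> #|top_set i f| = (rank f).+1.
Proof.
move=> wff lt_N; rewrite -(size_top i) cardE -(size_map val).
apply/perm_size/uniq_perm; rewrite ?(map_inj_uniq val_inj) ?enum_uniq ?top_uniq //.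
move=> k; apply/mapP/idP => [[x + ->]|kt]; first by rewrite mem_enum in_top_set.
have lt_k : k < N by have := top_bounds kt; lia.
by exists (Ordinal lt_k); rewrite ?mem_enum ?in_top_set.
Qed.

(** The enclosing piece is not listed, hence the extra [top_set] in the statements about a whole
    polygon. *)
Fixpoint pieces i f : seq {set 'I_N} :=
  match f with
  | Fnil => [::]
  | Fside f => pieces i.+1 f
  | Fpiece c f => top_set i c :: pieces i c ++ pieces (i + len c) f
  end.

Definition inside (i j : nat) F := [forall x in F, i <= x <= j].

Lemma insideP i j F : reflect (forall x, x \in F -> i <= x <= j) (inside i j F).
Proof. exact: forall_inP. Qed.

Lemma insideS i j i' j' F : i' <= i -> j <= j' -> inside i j F -> inside i' j' F.
Proof. by move=> h h' /insideP H; apply/insideP => x /H; lia. Qed.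

Fixpoint within i f F :=
  match f with
  | Fnil => false
  | Fside f => within i.+1 f F
  | Fpiece c f => inside i (i + len c) F || within (i + len c) f F
  end.

Lemma within_inside i f F : within i f F -> inside i (i + len f) F.
Proof.
elim: f i => //= [f IH|c _ f IH] i; first by move/IH; apply: insideS; lia.
by case/orP => [|/IH]; apply: insideS; lia.
Qed.

(** In a row of at least two members, none reaches from one end of the row to the other. *)
Lemma not_within i f F x y : wf f -> 1 < rank f -> x \in F -> x = i :> nat ->
  y \in F -> y = i + len f :> nat -> within i f F = false.
Proof.
move=> wff rf xF xi yF yj; apply/negP; case: f wff rf yj => //= [f|c f].
  by move=> _ _ _ /within_inside/insideP/(_ x xF); lia.
case/and3P=> rc /wf_rank_le_len lc /wf_rank_le_len lf rf yj.
by case/orP => [/insideP/(_ y yF)|/within_inside/insideP/(_ x xF)]; lia.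
Qed.

Lemma top_set_inside i f : inside i (i + len f) (top_set i f).
Proof. by apply/insideP => x; rewrite in_top_set => /top_bounds. Qed.

Lemma not_within_top_set i f : wf f -> 1 < rank f -> i + len f < N ->
  within i f (top_set i f) = false.
Proof.
move=> wff rf lt_N; have lt_i : i < N by lia.
apply: (@not_within _ _ _ (Ordinal lt_i) (Ordinal lt_N)) => //.
  by rewrite in_top_set top_first.
by rewrite in_top_set top_last.
Qed.

(** The base is exempted because it is itself in [D], except when it is the side from 0 to
    [N - 1]. *)
Definition nochord D i c := forall u v w,
  [/\ nat_of_ord u \in top i c, nat_of_ord v \in top i c & nat_of_ord w \in top i c] ->
  u < w < v -> joins D u v -> u = i :> nat /\ v = i + len c :> nat.

(** The piece enclosing the row is not constrained here; a separate [nochord] deals with it. *)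
Fixpoint compat D i f : Prop :=
  match f with
  | Fnil => True
  | Fside f => compat D i.+1 f
  | Fpiece c f => [/\ joins D i (i + len c), nochord D i c, compat D i c &
                      compat D (i + len c) f]
  end.

(** Two neighbours on the enclosing piece are the ends of one member of the row: a bare side, or a
    polygon whose base [compat] puts in [D]. *)
Lemma top_consecutive D i f a b : wf f -> compat D i f ->
  a \in top i f -> b \in top i f -> a < b ->
  (forall k, k \in top i f -> ~~ (a < k < b)) ->
  b = a.+1 \/ joins D a b /\ forall F, inside a b F -> within i f F.
Proof.
elim: f i => [|f IH|c _ f IH] i.
- by rewrite /= !inE => _ _ /eqP -> /eqP ->; rewrite ltnn.
- rewrite /= !inE => wff cp ha hb lt_ab H.
  have Hi k : k \in top i.+1 f -> ~~ (a < k < b) by move=> h; apply: H; rewrite inE h orbT.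
  have {}hb : b \in top i.+1 f.
    case/orP: hb => // /eqP bi; case/orP: ha => [|/top_bounds]; lia.
  case/orP: ha => [/eqP ai|ha]; last exact: IH.
  by left; have := Hi _ (top_first _ _); have := top_bounds hb; lia.
rewrite /= !inE => /and3P[rc wfc wff] [jc _ _ cp] ha hb lt_ab H.
have lc := wf_rank_le_len wfc.
have Hi k : k \in top (i + len c) f -> ~~ (a < k < b) by move=> h; apply: H; rewrite inE h orbT.
have {}hb : b \in top (i + len c) f.
  case/orP: hb => // /eqP bi; case/orP: ha => [|/top_bounds]; lia.
case/orP: ha => [/eqP ai|ha].
  right; have -> : b = i + len c by have := Hi _ (top_first _ _); have := top_bounds hb; lia.
  by rewrite ai; split=> // F ->.
case: (IH _ wff cp ha hb lt_ab Hi) => [->|[jab HF]]; [left|right] => //.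
by split=> // F /HF ->; rewrite orbT.
Qed.

Lemma top_gap i f k : i <= k <= i + len f -> k \notin top i f ->
  exists a b, [/\ a \in top i f, b \in top i f, a < k < b &
                  forall l, l \in top i f -> ~~ (a < l < b)].
Proof.
elim: f i => [|f IH|c _ f IH] i /=; rewrite !inE; first by lia.
  move=> b; rewrite negb_or => /andP[ne h].
  have [|a' [b' [ha hb hk H]]] := IH i.+1 _ h; first by lia.
  exists a', b'; rewrite !inE ha hb !orbT; split=> // l; rewrite inE => /orP[|/H//].
  by have := top_bounds ha; lia.
move=> b; rewrite negb_or => /andP[ne h].
have [le|lt] := leqP (i + len c) k.
  have [|a' [b' [ha hb hk H]]] := IH (i + len c) _ h; first by lia.
  exists a', b'; rewrite !inE ha hb !orbT; split=> // l; rewrite inE => /orP[|/H//].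
  by have := top_bounds ha; lia.
exists i, (i + len c); rewrite !inE eqxx top_first orbT; split=> //; first by lia.
by move=> l; rewrite inE => /orP[|/top_bounds]; lia.
Qed.

Lemma top_set_subpolygon D i c : wf c -> 1 < rank c -> i + len c < N ->
  edge D i (i + len c) -> compat D i c -> nochord D i c -> top_set i c \in subpolygons D.
Proof.
move=> wfc rc lt_N ed cp nc; apply/subpolygonP.
have lt_i : i < N by lia.
have iF : Ordinal lt_i \in top_set i c by rewrite in_top_set top_first.
have jF : Ordinal lt_N \in top_set i c by rewrite in_top_set top_last.
split; first by rewrite card_top_set.
- move=> x y; rewrite !in_top_set => xt yt xy H.
  have [|->|[jxy _]] := top_consecutive wfc cp xt yt xy; rewrite /edge ?eqxx ?jxy ?orbT //.
  move=> k kt; have lt_k : k < N by have := top_bounds kt; lia.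
  by apply: (H (Ordinal lt_k)); rewrite in_top_set.
- move=> x y; rewrite !in_top_set => xt yt xy H.
  have := H _ iF; have := H _ jF; have := top_bounds xt; have := top_bounds yt => /=.
  move=> h1 h2 h3 h4; have -> : nat_of_ord x = i by lia.
  by have -> : nat_of_ord y = i + len c by lia.
move=> x y z w; rewrite !in_top_set => xt yt zt wt zb wb; apply/negP => jxy.
have [|h1 h2] := nc x y z _ zb jxy; first by [].
by move: wb; rewrite h1 h2 (top_bounds wt).
Qed.

Ltac nat_lia :=
  repeat match goal with
  | H : forall _, _ |- _ => clear H
  | H : is_true (_ \in _) |- _ => clear H
  | H : is_true (joins _ _ _) |- _ => clear H
  | H : is_true (edge _ _ _) |- _ => clear H
  | H : is_true (wf _) |- _ => clear H
  | H : is_true (~~ within _ _ _) |- _ => clear H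
  | H : is_true (~~ inside _ _ _) |- _ => clear H
  | H : is_true (_ < #|_|) |- _ => clear H
  end; lia.

(* A sub-polygon of D below the base (i, i + len c) but below no other edge of
   the base piece is that piece: a side of F leaving a gap between two
   consecutive top vertices would cross the member of D closing the gap. *)
Lemma subpolygon_split D i c F : dissection D -> wf c -> 1 < rank c ->
  i + len c < N -> compat D i c -> nochord D i c ->
  F \in subpolygons D -> inside i (i + len c) F -> ~~ within i c F -> F = top_set i c.
Proof.
move=> /dissection_joins[D1 D2] wfc rc lt_N cp nc /subpolygonP[cF Fcons Fend Fdiag] /insideP inF nw.
have tN k : k \in top i c -> {x : 'I_N | x = k :> nat}.
  by move=> kt; have lt_k : k < N by [have := top_bounds kt; lia]; exists (Ordinal lt_k).
have not_two (x y : 'I_N) : exists2 w, w \in F & (w != x :> nat) && (w != y :> nat).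
  apply/exists_inP; apply: contraLR (cF); rewrite negb_exists_in -leqNgt => /forall_inP H.
  apply: leq_trans (_ : #|[set x; y]| <= 2); last by rewrite cards2; case: eqP.
  apply: subset_leq_card; by apply/subsetP => w /H; rewrite negb_and !negbK !inE -!(inj_eq val_inj).
have [a0 a0F] : exists a, a \in F by apply/card_gt0P; apply: leq_trans cF.
(* The least and greatest vertices [a] and [b] of [F] are the ends of its closing side. *)
have [a [aF _ amin]] := min_above a0F (leq0n a0).
have [b [bF _ bmax]] := max_below a0F (ltnW (ltn_ord a0)).
have {}amin : forall w, w \in F -> a <= w by move=> w wF; apply: amin.
have {}bmax : forall w, w \in F -> w <= b by move=> w wF; apply: bmax => //;
  have := ltn_ord w; nat_lia.
have ab_out : forall w, w \in F -> a <= w <= b by move=> w wF; rewrite amin ?bmax.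
have lt_ab : a < b.
  have [w wF /andP[wa wb]] := not_two a b; have := ab_out w wF.
  by nat_lia.
have ab1 : (nat_of_ord b == a.+1) = false.
  have [w wF /andP[wa wb]] := not_two a b; have := ab_out w wF.
  by nat_lia.
(* A vertex missing from the base piece is cut off by a chord [st] in [D], and [F] sticks out of the
   interval from [s] to [t] since it is not within a member. *)
have gap k : i <= k <= i + len c -> k \notin top i c -> exists s t,
    [/\ s \in top i c, t \in top i c, s < k < t, joins D s t & ~~ inside s t F].
  move=> kb /(top_gap kb)[s [t [st tt kst H]]]; have lt_st : s < t by nat_lia.
  have [|[jst HF]] := top_consecutive wfc cp st tt lt_st H; first by nat_lia.
  by exists s, t; split=> //; apply: contra nw => /HF.
have ab_edge := Fend a b aF bF lt_ab ab_out.
(* Otherwise [s < a < t < b], so the closing side [ab] is in [D] and crosses [st]. The argument for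
   [b] is symmetric. *)
have aT : nat_of_ord a \in top i c.
  apply/negPn/negP => /gap[|s [t [st tt kst jst /insideP nin]]]; first exact: inF.
  have lt_tb : t < b.
    by rewrite ltnNge; apply/negP => le_bt; apply: nin => w /ab_out; nat_lia.
  have jab : joins D a b by move: ab_edge; rewrite /edge ab1; case: eqP => //= a0'; nat_lia.
  by have := D2 _ _ _ _ jst jab; nat_lia.
have bT : nat_of_ord b \in top i c.
  apply/negPn/negP => /gap[|s [t [st tt kst jst /insideP nin]]]; first exact: inF.
  have lt_as : a < s.
    by rewrite ltnNge; apply/negP => le_sa; apply: nin => w /ab_out; nat_lia.
  have jab : joins D a b.
    by move: ab_edge; have := top_bounds tt; rewrite /edge ab1; case: (_ =P N.-1);
      rewrite ?andbF //=; nat_lia.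
  by have := D2 _ _ _ _ jab jst; nat_lia.
(* Unless [ab] is the side from 0 to [N - 1], it is in [D]. If it passes over another top vertex it
   is the base by [nochord]; otherwise it closes one gap and [F] would be within a member. *)
have [ai bj] : a = i :> nat /\ b = i + len c :> nat.
  have ha := inF a aF; have hb := inF b bF.
  have [/andP[/eqP a0' /eqP bN]|nroot] := boolP ((nat_of_ord a == 0) && (nat_of_ord b == N.-1)).
    by nat_lia.
  have jab : joins D a b.
    by move: ab_edge; rewrite /edge ab1 (negbTE nroot).
  have [/hasP[k kt kb]|/hasPn H] := boolP (has (fun k => a < k < b) (top i c)).
    have [w wk] := tN k kt; apply: (nc a b w _ _ jab); last by rewrite wk.
    by rewrite aT bT wk kt.
  have [|[_ HF]] := top_consecutive wfc cp aT bT lt_ab H.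
    by move/eqP; rewrite ab1.
  by case/negP: nw; apply: HF; apply/insideP.
have sub_top w : w \in F -> nat_of_ord w \in top i c.
  move=> wF; apply/negPn/negP => /gap[|s [t [st tt kst jst nin]]]; first exact: inF.
  have hs := top_bounds st; have ht := top_bounds tt.
  (* The sides of [F] entering and leaving the gap cannot cross [st], so [s] and [t] are vertices of
     [F]. With [w] inside the gap and another vertex outside, [st] is a diagonal of [F] lying in
     [D], a contradiction. *)
  have [p [pF ps pmax]] : exists p, [/\ p \in F, p <= s & forall w, w \in F -> w <= s -> w <= p].
    by apply: (max_below aF); nat_lia.
  have [q [qF qs qmin]] : exists q, [/\ q \in F, s.+1 <= q & forall w, w \in F ->
    s.+1 <= w -> q <= w].
    by apply: (min_above wF); nat_lia.
  have lt_pq : p < q by nat_lia.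
  have qw : q <= w by apply: qmin => //; nat_lia.
  have pq : edge D p q.
    by apply: Fcons => // w' w'F; have := pmax w' w'F; have := qmin w' w'F; nat_lia.
  have ps' : p = s :> nat.
    apply/eqP; rewrite eqn_leq ps leqNgt; apply/negP => lt_ps.
    have jpq : joins D p q by move: pq; rewrite /edge; nat_lia.
    by have := D2 _ _ _ _ jpq jst; nat_lia.
  have [q2 [q2F q2t q2min]] : exists q, [/\ q \in F, t <= q & forall w, w \in F ->
    t <= w -> q <= w].
    by apply: (min_above bF); nat_lia.
  have [p2 [p2F p2t p2max]] : exists p, [/\ p \in F, p <= t.-1 & forall w, w \in F ->
    w <= t.-1 -> w <= p].
    by apply: (max_below wF); nat_lia.
  have lt_pq2 : p2 < q2 by nat_lia.
  have wp2 : w <= p2 by apply: p2max => //; nat_lia.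
  have pq2 : edge D p2 q2.
    by apply: Fcons => // w' w'F; have := p2max w' w'F; have := q2min w' w'F; nat_lia.
  have qt' : q2 = t :> nat.
    apply/eqP; rewrite eqn_leq q2t andbT leqNgt; apply/negP => lt_tq.
    have jpq : joins D p2 q2 by move: pq2; rewrite /edge; nat_lia.
    by have := D2 _ _ _ _ jst jpq; nat_lia.
  move: nin; rewrite negb_forall_in => /exists_inP[z zF zo].
  have := Fdiag p q2 w z pF q2F wF zF; rewrite ps' qt' jst kst => H.
  by have := H isT zo.
apply/setP => x; rewrite in_top_set; apply/idP/idP => [/sub_top //|xt].
(* A missing top vertex [x] is passed over by a side [pq] of [F], which is then in [D]; [nochord]
   makes it the base, leaving no room for a third vertex [w] of [F]. *)
apply/negPn/negP => xF.
have xb := top_bounds xt.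
have neq w : w \in F -> nat_of_ord w != x.
  by move=> wF; apply: contraNneq xF => /val_inj <-.
have [p [pF px pmax]] : exists p, [/\ p \in F, p <= x & forall w, w \in F -> w <= x -> w <= p].
  by apply: (max_below aF); nat_lia.
have [q [qF qx qmin]] : exists q, [/\ q \in F, x <= q & forall w, w \in F -> x <= w -> q <= w].
  by apply: (min_above bF); nat_lia.
have np := neq p pF; have nq := neq q qF.
have lt_pq : p < q by nat_lia.
have pq : edge D p q.
  apply: Fcons => // w wF; have := neq w wF; have := pmax w wF; have := qmin w wF; nat_lia.
have hp := ab_out p pF; have hq := ab_out q qF.
have [w wF /andP[wp wq]] := not_two p q; have wb := ab_out w wF.
have wpq : ~~ (p < w < q) by have := pmax w wF; have := qmin w wF; have := neq w wF; nat_lia.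
have nroot : (nat_of_ord p == 0) && (nat_of_ord q == N.-1) = false by nat_lia.
have jpq : joins D p q by move: pq; rewrite /edge nroot; nat_lia.
have [||hpi hqi] := nc p q x _ _ jpq; [by split => //; apply: sub_top|nat_lia|nat_lia].
Qed.
End Polygon.

(** * The pieces of a forest are the sub-polygons of the dissection *)

Section Polygon.
Variable N : nat.
Implicit Types (x y u v w : 'I_N) (F : {set 'I_N}) (D : {set {set 'I_N}}).
Local Notation pieces := (@pieces N).

Lemma pieces_within i f F : wf f -> i + len f < N -> F \in pieces i f ->
  within i f F /\ 2 < #|F|.
Proof.
elim: f i => //= [f IH|c IHc f IHf] i; first by move=> wff lt_N; apply: IH => //; lia.
case/and3P=> rc wfc wff lt_N; rewrite inE mem_cat => /or3P[/eqP ->|Fc|Ff].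
- by rewrite top_set_inside card_top_set //; lia.
- have [|/within_inside -> ->] := IHc i wfc _ Fc; by [|lia].
have [|-> ->] := IHf (i + len c) wff _ Ff; by [rewrite orbT|lia].
Qed.

Lemma pieces_subpolygon D i f F : dissection D -> wf f -> compat D i f ->
  i + len f < N -> F \in subpolygons D -> within i f F = (F \in pieces i f).
Proof.
move=> dD; elim: f i => // [f IH|c IHc f IHf] i.
  by move=> /= wff cp lt_N; apply: IH => //; lia.
case/and3P=> rc wfc wff [jc nc cc cf] /= lt_N sF.
have lt_Nc : i + len c < N by lia.
rewrite inE mem_cat IHf //; last by lia.
rewrite -IHc //.
case: (F \in pieces (i + len c) f); rewrite ?orbT // !orbF.
apply/idP/orP => [inF|[/eqP ->|]]; [|exact: top_set_inside|exact: within_inside].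
case: (boolP (within i c F)) => [|nw]; [by right|left].
by apply/eqP; apply: (subpolygon_split dD wfc rc lt_Nc cc nc).
Qed.

Lemma pieces_sub_subpolygons D i f F : wf f -> compat D i f ->
  i + len f < N -> F \in pieces i f -> F \in subpolygons D.
Proof.
elim: f i => // [f IH|c IHc f IHf] i.
  by move=> /= wff cp lt_N; apply: IH => //; lia.
case/and3P=> rc wfc wff [jc nc cc cf] /= lt_N.
rewrite inE mem_cat => /or3P[/eqP ->|Fc|Ff]; last 2 first.
- by apply: IHc Fc => //; lia.
- by apply: IHf Ff => //; lia.
by apply: top_set_subpolygon => //; [lia|rewrite /edge jc !orbT].
Qed.

(** The whole polygon is one row on the base from 0 to [N - 1], a side of the polygon rather than a
    member of [D]. *)
Lemma subpolygons_forest D f : dissection D -> wf f -> 1 < rank f ->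
  (len f).+1 = N -> compat D 0 f -> nochord D 0 f ->
  subpolygons D =i top_set N 0 f :: pieces 0 f.
Proof.
move=> dD wff rf lN cp nc F; have lt_N : 0 + len f < N by lia.
rewrite in_cons; apply/idP/orP => [sF|[/eqP ->|]]; last exact: pieces_sub_subpolygons wff cp lt_N.
  rewrite -(pieces_subpolygon dD wff cp lt_N sF).
  case: (boolP (within 0 f F)) => [|nw]; [by right|left].
  apply/eqP; apply: (subpolygon_split dD) => //.
  by apply/insideP => x _; have := ltn_ord x; lia.
by apply: top_set_subpolygon => //; apply/or3P; constructor 2; apply/eqP; rewrite add0n; lia.
Qed.

(** Polygons in different members share at most one vertex, while a piece has at least three. A base
    piece contains both ends of its row, so it does not recur among the pieces above it. *)
Lemma pieces_uniq i f : wf f -> i + len f < N -> uniq (pieces i f).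
Proof.
elim: f i => //= [f IH|c IHc f IHf] i; first by move=> wff lt_N; apply: IH => //; lia.
case/and3P=> rc wfc wff lt_N; have lc := wf_rank_le_len wfc.
have dis F : within i c F || (F == top_set N i c) -> F \in pieces (i + len c) f -> False.
  move=> Fc Ff; have [|/within_inside/insideP H1 cF] := pieces_within wff _ Ff; first by lia.
  have /insideP H2 : inside i (i + len c) F.
    by case/orP: Fc => [/within_inside //|/eqP ->]; apply: top_set_inside.
  have : #|F| <= 1; last by lia.
  apply/card_le1_eqP => x y xF yF; apply: val_inj => /=.
  by have := H1 x xF; have := H2 x xF; have := H1 y yF; have := H2 y yF; lia.
rewrite mem_cat negb_or cat_uniq IHc ?IHf //=; [|lia..].
rewrite andbT; apply/andP; split; first (apply/andP; split).
- apply/negP => /(pieces_within wfc)[|]; first by lia.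
  by rewrite not_within_top_set //; lia.
- by apply/negP => /dis; apply; rewrite eqxx orbT.
apply/hasPn => F Ff; apply/negP => /(pieces_within wfc)[|Fw _]; first by lia.
by apply: (dis F) => //; rewrite Fw.
Qed.

Lemma all_pieces_uniq f : wf f -> 1 < rank f -> len f < N ->
  uniq (top_set N 0 f :: pieces 0 f).
Proof.
move=> wff rf lt_N; rewrite /= pieces_uniq // andbT.
apply/negP => /(pieces_within wff)[|]; first by lia.
by rewrite not_within_top_set.
Qed.

Lemma pieces_dvd3 i f : wf f -> i + len f < N ->
  all (fun F => 3 %| #|F|) (pieces i f) = is_3d f.
Proof.
elim: f i => //= [f IH|c IHc f IHf] i; first by move=> wff lt_N; apply: IH => //; lia.
case/and3P=> rc wfc wff lt_N; rewrite all_cat card_top_set //; last by lia.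
by rewrite IHc ?IHf //; lia.
Qed.

(** Ties the recursion of [quid] to incidences: [e] is credited exactly at the vertices of the
    enclosing piece. *)
Lemma quid_count e i f x : wf f -> i + len f < N -> i <= x ->
  quid e f (x - i) = e * (nat_of_ord x \in top i f) + count (fun F => x \in F) (pieces i f).
Proof.
elim: f e i => [|f IH|c IHc f IHf] e i /=.
- by move=> _ _ le_ix; rewrite addn0 inE; congr (_ * nat_of_bool _); lia.
- move=> wff lt_N le_ix; rewrite inE.
  have [xi|xi] := eqVneq (nat_of_ord x) i.
    rewrite xi subnn eqxx /=; congr (_ + _).
    apply/esym/eqP; rewrite -leqn0 leqNgt -has_count; apply/hasPn => F FP.
    have [|/within_inside/insideP H _] := pieces_within wff _ FP; first by lia.
    by apply/negP => /H; lia.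
  have -> : x - i = (x - i.+1).+1 by lia.
  by rewrite muln0 IH //; lia.
case/and3P=> rc wfc wff lt_N le_ix; have lc := wf_rank_le_len wfc.
rewrite inE in_top_set count_cat IHc //; last by lia.
rewrite mul1n; have -> : (x - i == 0) = (nat_of_ord x == i) by lia.
have [le|lt] := leqP (len c) (x - i).
  rewrite -subnDA IHf //; [|lia..].
  have -> : (nat_of_ord x == i) = false by lia.
  by rewrite muln0 /=; lia.
have -> : (nat_of_ord x \in top (i + len c) f) = false by apply/negP => /top_bounds; lia.
have -> : count (fun F => x \in F) (pieces (i + len c) f) = 0.
  apply/eqP; rewrite -leqn0 leqNgt -has_count; apply/hasPn => F FP.
  have [|/within_inside/insideP H _] := pieces_within wff _ FP; first by lia.
  by apply/negP => /H; lia.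
by rewrite orbF !addn0.
Qed.

(** * Passing between forests and dissections *)

Fixpoint diags i f : seq (nat * nat) :=
  match f with
  | Fnil => [::]
  | Fside f => diags i.+1 f
  | Fpiece c f => (i, i + len c) :: diags i c ++ diags (i + len c) f
  end.

Lemma diags_bounds i f a b : wf f -> (a, b) \in diags i f ->
  [/\ i <= a, a.+1 < b, b <= i + len f & 1 < rank f -> ~~ ((a == i) && (b == i + len f))].
Proof.
elim: f i => //= [f IH|c IHc f IHf] i.
  by move=> /IH{}IH /IH[h1 h2 h3 h4]; split; lia.
case/and3P=> rc wfc wff; have lc := wf_rank_le_len wfc; have lf := wf_rank_le_len wff.
rewrite inE mem_cat => /or3P[/eqP[-> ->]|/(IHc _ wfc)[h1 h2 h3 h4]|/(IHf _ wff)[h1 h2 h3 h4]].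
- by split; lia.
- by split; lia.
by split; lia.
Qed.

Lemma diags_noncrossing i f a b a' b' : wf f -> (a, b) \in diags i f ->
  (a', b') \in diags i f -> ~~ [&& a < a', a' < b & b < b'].
Proof.
elim: f i => //= [f IH|c IHc f IHf] i; first exact: IH.
case/and3P=> rc wfc wff; rewrite !inE !mem_cat.
move=> /or3P[/eqP[-> ->]|H|H] /or3P[/eqP[-> ->]|H'|H'].
- by lia.
- by have [] := diags_bounds wfc H'; lia.
- by have [] := diags_bounds wff H'; lia.
- by have [] := diags_bounds wfc H; lia.
- exact: IHc H H'.
- by have [? ? ? _] := diags_bounds wfc H; have [? ? ? _] := diags_bounds wff H'; lia.
- by have [? ? ? _] := diags_bounds wff H; lia.
- by have [? ? ? _] := diags_bounds wff H; have [? ? ? _] := diags_bounds wfc H'; lia.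
exact: IHf H H'.
Qed.

Lemma diags_top i f a b k : wf f -> (a, b) \in diags i f -> k \in top i f -> ~~ (a < k < b).
Proof.
elim: f i => //= [f IH|c IHc f IHf] i.
  move=> wff H; rewrite inE => /orP[/eqP ->|]; last exact: IH.
  by have [] := diags_bounds wff H; lia.
case/and3P=> rc wfc wff; rewrite !inE !mem_cat.
move=> /or3P[/eqP[-> ->]|H|H] /orP[/eqP ->|kt].
- by lia.
- by have := top_bounds kt; lia.
- by have [] := diags_bounds wfc H; lia.
- by have [] := diags_bounds wfc H; have := top_bounds kt; lia.
- by have [] := diags_bounds wff H; lia.
exact: IHf H kt.
Qed.

(** The base of the row is allowed in [D] because, on recursion into a piece, that base is a member
    of [D]. *)
Lemma compat_diags D i f : wf f ->
  (forall a b, (a, b) \in diags i f -> joins D a b) ->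
  (forall a b, a < b -> i <= a -> b <= i + len f -> joins D a b ->
     (a, b) \in diags i f \/ (a, b) = (i, i + len f)) ->
  compat D i f /\ nochord D i f.
Proof.
move=> wff H1 H2; split; last first.
  move=> u v w [ut vt wt] uwv juv.
  have := top_bounds ut; have := top_bounds vt => hv hu.
  have [|||/(diags_top wff)/(_ wt)|[-> ->]] := H2 u v _ _ _ juv; by [lia|].
elim: f i wff H1 H2 => //= [f IH|c IHc f IHf] i.
  move=> wff H1 H2; apply: IH => // a b ab ia bi jab.
  by have [||||[? ?]] := H2 a b _ _ _ jab; by [lia|left].
case/and3P=> rc wfc wff H1 H2; have lc := wf_rank_le_len wfc.
have H1c a b : (a, b) \in diags i c -> joins D a b by move=> h; apply: H1;
  rewrite inE mem_cat h orbT.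
have H1f a b : (a, b) \in diags (i + len c) f -> joins D a b by move=> h; apply: H1;
  rewrite inE mem_cat h !orbT.
have H2c a b : a < b -> i <= a -> b <= i + len c -> joins D a b ->
     (a, b) \in diags i c \/ (a, b) = (i, i + len c).
  move=> ab ia bi jab; have [||||] := H2 a b _ _ _ jab; [lia..| |].
    rewrite inE mem_cat => /or3P[/eqP ->|->|/(diags_bounds wff)[]]; [by right|by left|lia].
  by case=> -> bE; right; congr (_, _); lia.
split.
- by apply: H1; rewrite inE eqxx.
- move=> u v w [ut vt wt] uwv juv.
  have := top_bounds ut; have := top_bounds vt => hv hu.
  have [|||/(diags_top wfc)/(_ wt)|[-> ->]] := H2c u v _ _ _ juv; by [lia|].
- exact: IHc.
apply: IHf => // a b ab ia bi jab.
have [||||] := H2 a b _ _ _ jab; [lia..| |by case; lia].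
by rewrite inE mem_cat => /or3P[/eqP[]|/(diags_bounds wfc)[]|]; [lia|lia|left].
Qed.

Definition forest_dissection f : {set {set 'I_N}} :=
  [set [set p.1; p.2] | p : 'I_N * 'I_N & (nat_of_ord p.1, nat_of_ord p.2) \in diags 0 f].

Lemma joins_forest_dissection f a b : wf f -> (len f).+1 = N -> a < b ->
  joins (forest_dissection f) a b = ((a, b) \in diags 0 f).
Proof.
move=> wff lN ab; apply/idP/idP => [/joinsP[x [y [ax bx /imsetP[[u v]]]]]|H].
  rewrite inE /= => H; have [_ uv _ _] := diags_bounds wff H; subst a b.
  by case/(set2_lt ab) => -[uE vE]; subst u v => //; lia.
have [_ _ bN _] := diags_bounds wff H.
have bN' : b < N by lia.
have aN : a < N by lia.
have -> : a = Ordinal aN by []. have -> : b = Ordinal bN' by [].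
by rewrite joinsE; apply/imsetP; exists (Ordinal aN, Ordinal bN'); rewrite ?inE.
Qed.

Lemma forest_dissectionP f : wf f -> 1 < rank f -> (len f).+1 = N ->
  [/\ dissection (forest_dissection f), compat (forest_dissection f) 0 f & nochord (forest_dissection f) 0 f].
Proof.
move=> wff rf lN.
have jE a b : joins (forest_dissection f) a b -> a < b -> (a, b) \in diags 0 f.
  by move=> jab ab; rewrite -joins_forest_dissection.
have [] := @compat_diags (forest_dissection f) 0 f wff.
- by move=> a b H; rewrite joins_forest_dissection //; have [] := diags_bounds wff H; lia.
- by move=> a b ab _ _ jab; left; apply: jE.
move=> cp nc; split=> //; apply: joins_dissection.
- move=> e /imsetP[[u v]]; rewrite inE /= => /(diags_bounds wff)[_ uv _ _] ->.
  by exists u, v; split=> //; lia.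
- move=> a b jab ab; have [_ h1 h2 /(_ rf) h3] := diags_bounds wff (jE _ _ jab ab).
  by split; lia.
move=> a b k l ab kl jab jkl.
exact: diags_noncrossing (jE _ _ jab ab) (jE _ _ jkl kl).
Qed.

(** Walks from [i] to [j] along the piece on the base [ij]. Each step is a bare side or a chord of
    [D]; the polygon cut off by a chord is treated by induction on the length of the interval. *)
Lemma exists_forest D i j : dissection D -> i.+1 < j -> j < N ->
  exists f, [/\ wf f, i + len f = j, 1 < rank f, compat D i f & nochord D i f].
Proof.
move=> /dissection_joins[D1 _].
have [m] := ubnP (j - i); elim: m i j => // m IH i j /ltnSE le_m lt_ij lt_jN.
(* The row built is the part of the walk from [k] to [j]. From [i] at least two steps are needed
   because the base is forbidden as a step; from a later [k < j], at least one. *)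
have main n k : j - k <= n -> i <= k <= j -> exists f,
    [/\ wf f, k + len f = j, (if k == i then 2 else k < j) <= rank f, compat D k f &
      forall u v w, [/\ nat_of_ord u \in top k f, nat_of_ord v \in top k f & nat_of_ord w \in top k f] ->
        u < w < v -> joins D u v -> u = i :> nat /\ v = j :> nat].
  elim: n k => [|n IHn] k le_n kb.
    have -> : k = j by lia.
    exists Fnil; rewrite /= addn0; split=> //; first by rewrite ifF; lia.
    by move=> u v w; rewrite !inE => -[]; lia.
  have [->|kj] := eqVneq k j.
    exists Fnil; rewrite /= addn0; split=> //; first by rewrite ifF; lia.
    by move=> u v w; rewrite !inE => -[]; lia.
  pose P b := [&& k < b, b <= j, (b == k.+1) || joins D k b & ~~ ((k == i) && (b == j))].
  have exP : exists b, P b by exists k.+1; rewrite /P; lia.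
  have ubP b : P b -> b <= j by case/and4P.
  (* The furthest possible next vertex is chosen, so D has no chord from k. *)
  have [b /and4P[kb' bj jkb nij] bmax] := ex_maxnP exP ubP.
  have [||f [wff lf rf cf ncf]] := IHn b; [lia..|].
  have nc' u v w : (nat_of_ord u == k) || (nat_of_ord u \in top b f) ->
      (nat_of_ord v == k) || (nat_of_ord v \in top b f) ->
      (nat_of_ord w == k) || (nat_of_ord w \in top b f) ->
      u < w < v -> joins D u v -> u = i :> nat /\ v = j :> nat.
    have bt (t : 'I_N) : nat_of_ord t \in top b f -> b <= t by move/top_bounds; lia.
    move=> hu hv hw uwv juv.
    have {}hv : nat_of_ord v \in top b f by case/orP: hv hu => // vk /orP[|/bt]; lia.
    have {}hw : nat_of_ord w \in top b f by case/orP: hw hu => // wk /orP[|/bt]; lia.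
    case/orP: hu => [/eqP uk|ut]; last exact: (ncf u v w).
    have vb := top_bounds hv; have wb := bt _ hw.
    have [/andP[/eqP ki /eqP vj]|nr] := boolP ((k == i) && (nat_of_ord v == j)); first by lia.
    have : nat_of_ord v <= b by apply: bmax; rewrite /P nr -uk juv !orbT; lia.
    by lia.
  have rk : (if k == i then 2 else k < j) <= (rank f).+1.
    by move: rf nij; case: (k == i); case: (b == i); lia.
  have [bk|bk] := eqVneq b k.+1.
    exists (Fside f); subst b; split=> //=; first by lia.
    by move=> u v w [ut vt wt]; rewrite !inE in ut vt wt; apply: nc' wt.
  have jb : joins D k b by move: jkb; rewrite (negbTE bk).
  have lt_kb : k.+1 < b by lia.
  have [|||c [wfc lc rc cc ncc]] := IH k b; [lia..|].
  exists (Fpiece c f); rewrite /= lc; split=> //; first by rewrite rc wfc.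
    by lia.
  by move=> u v w [ut vt wt]; rewrite !inE in ut vt wt; apply: nc' wt.
have [|f [wff lf rf cf ncf]] := main (j - i) i (leqnn _); first by lia.
exists f; rewrite eqxx in rf; split=> // u v w h uwv juv.
by rewrite lf; apply: ncf h uwv juv.
Qed.
End Polygon.

Local Open Scope ring_scope.

(** * Words in T and J *)

Lemma mx2M a b c d a' b' c' d' :
  mx2 a b c d * mx2 a' b' c' d' =
  mx2 (a * a' + b * c') (a * b' + b * d') (c * a' + d * c') (c * b' + d * d').
Proof.
apply/matrixP => i j; rewrite !mxE !big_ord_recl big_ord0 !mxE addr0 /=.
by case: (i == 0); case: (j == 0).
Qed.

Lemma mx2_1 : mx2 1 0 0 1 = 1.
Proof.
apply/matrixP => i j; rewrite !mxE.
by case: i j => [[|[|//]] hi] [[|[|//]] hj].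
Qed.

Lemma mx2N a b c d : - mx2 a b c d = mx2 (- a) (- b) (- c) (- d).
Proof. by apply/matrixP => i j; rewrite !mxE; do 2 case: ifP. Qed.

Lemma mx2_inj a b c d a' b' c' d' :
  mx2 a b c d = mx2 a' b' c' d' -> [/\ a = a', b = b', c = c' & d = d'].
Proof.
move=> E; have e i j : mx2 a b c d i j = mx2 a' b' c' d' i j by rewrite E.
by have:= (e 0 0, e 0 1, e 1 0, e 1 1); rewrite !mxE /= => -[[[]]].
Qed.

(** The power of [T] with exponent [x], negative exponents included. *)
Definition U (x : int) := mx2 1 x 0 1.
Definition J := mx2 0 (-1) 1 0.

Lemma U0 : U 0 = 1. Proof. exact: mx2_1. Qed.

Lemma UD x y : U (x + y) = U x * U y.
Proof. by rewrite /U mx2M; congr mx2; ring. Qed.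

Lemma UJE x : U x * J = mx2 x (-1) 1 0.
Proof. by rewrite /U /J mx2M; congr mx2; ring. Qed.

Lemma JJ : J * J = -1.
Proof. by rewrite /J mx2M -mx2_1 mx2N; congr mx2; ring. Qed.

Lemma U1J3 : (U 1 * J) ^+ 3 = -1.
Proof. by rewrite UJE !exprS expr0 mulr1 !mx2M -mx2_1 mx2N; congr mx2; ring. Qed.

Definition eqpm (A B : 'M[int]_2) := A = B \/ A = - B.

Lemma eqpm_refl A : eqpm A A. Proof. by left. Qed.

Lemma eqpm_sym A B : eqpm A B -> eqpm B A.
Proof. by case=> ->; [left|right; rewrite opprK]. Qed.

Lemma eqpm_trans B A C : eqpm A B -> eqpm B C -> eqpm A C.
Proof. by case=> -> [->|->]; [left|right|right|left; rewrite opprK]. Qed.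

Lemma eqpmM A B A' B' : eqpm A A' -> eqpm B B' -> eqpm (A * B) (A' * B').
Proof.
by case=> -> [->|->]; rewrite ?mulrNN ?mulrN ?mulNr; [left|right|right|left].
Qed.

Lemma eqpmN A : eqpm (- A) A. Proof. by right. Qed.

Lemma M_cat s t : M (s ++ t) = M t * M s.
Proof. by rewrite /M rev_cat big_cat. Qed.

Lemma M_seq1 x : M [:: x] = mx2 x (-1) 1 0.
Proof. by rewrite /M big_seq1. Qed.

Lemma M_cons x s : M (x :: s) = M s * mx2 x (-1) 1 0.
Proof. by rewrite -cat1s M_cat M_seq1. Qed.

Lemma M_rcons s x : M (rcons s x) = mx2 x (-1) 1 0 * M s.
Proof. by rewrite -cats1 M_cat M_seq1. Qed.

Lemma M_nil : M [::] = 1. Proof. by rewrite /M big_nil. Qed.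

(** One [U] per vertex and one [J] per side of a path. Without the final [J] of [M], both ends are
    powers of [T], so that paths can be glued at a vertex. *)
Fixpoint word (g : nat -> nat) n : 'M[int]_2 :=
  if n is m.+1 then U (g n)%:Z * J * word g m else U (g 0%N)%:Z.

Lemma M_mkseq g n : M (map Posz (mkseq g n.+1)) = word g n * J.
Proof.
elim: n => [|n IH]; first by rewrite /= M_seq1 UJE.
by rewrite mkseqS map_rcons M_rcons IH /= UJE mulrA.
Qed.

(** The common vertex [m] is counted in both words; the middle factor removes one copy. *)
Lemma word_add g m n :
  word g (m + n) = word (fun i => g (m + i)%N) n * U (- (g m)%:Z) * word g m.
Proof.
elim: n => [|n IH]; first by rewrite /= !addn0 -UD subrr U0 mul1r.
by rewrite addnS /= IH !mulrA addnS.
Qed.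

Lemma eq_word g h n : (forall i, (i <= n)%N -> g i = h i) -> word g n = word h n.
Proof.
elim: n => [|n IH] gh /=; first by rewrite gh.
by rewrite gh // IH // => i /leqW /gh.
Qed.

Lemma word_addl g x n : word (fun i => g i + x * (i == 0))%N n = word g n * U x%:Z.
Proof.
elim: n => [|n IH] /=; first by rewrite muln1 PoszD UD.
by rewrite muln0 addn0 IH !mulrA.
Qed.

Lemma word_addr g x n : word (fun i => g i + x * (i == n))%N n = U x%:Z * word g n.
Proof.
case: n => [|n] /=; first by rewrite muln1 PoszD addrC UD.
rewrite eqxx muln1 PoszD addrC UD !mulrA; congr (_ * _).
by apply: eq_word => i le_in; rewrite ltn_eqF ?muln0 ?addn0.
Qed.

(** At the junction the pieces of [c] and those of [f] add up, so the exponent splits between the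
    two words; the last factor is the enclosing piece at the first vertex. *)
Lemma word_piece c f e : (0 < len c)%N ->
  word (quid e (Fpiece c f)) (len c + len f) =
  word (quid e f) (len f) * word (quid 1 c) (len c) * U e%:Z.
Proof.
move=> c0; rewrite word_add.
have -> : word (quid e (Fpiece c f)) (len c)
        = U (quid e f 0)%:Z * word (quid 1 c) (len c) * U e%:Z.
  rewrite -word_addr -word_addl; apply: eq_word => i le_ic /=.
  have [->|ne] := eqVneq i (len c).
    by rewrite leqnn subnn muln1 -addnA addnC.
  by rewrite ifF ?muln0 ?addn0 1?addnC //; lia.
have -> : word (fun i => quid e (Fpiece c f) (len c + i)%N) (len f)
        = word (quid e f) (len f) * U (quid 1 c (len c))%:Z.
  rewrite -word_addl; apply: eq_word => i le_if /=.
  rewrite leq_addr addKn (_ : (len c + i == 0)%N = false) ?muln0; last by lia.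
  case: i le_if => [|i] _; first by rewrite addn0 muln1 addnC.
  by rewrite quid_out ?muln0 ?addn0 //; lia.
have -> : quid e (Fpiece c f) (len c) = (quid 1 c (len c) + quid e f 0)%N.
  by rewrite /= leqnn subnn (_ : (len c == 0)%N = false) ?muln0; lia.
rewrite -!mulrA; congr (_ * _).
by rewrite !mulrA -!UD PoszD opprD addNKr addNr U0 mul1r.
Qed.

(** A member of the row contributes the same as a bare side: closing the word of [c] by its base
    gives a power of [U 1 * J] with exponent divisible by 3, hence a sign. *)
Lemma word_forest e f : is_3d f ->
  eqpm (word (quid e f) (len f)) ((U e%:Z * J) ^+ rank f * U e%:Z).
Proof.
elim: f e => [|f IH|c IHc f IHf] e.
- by move=> _; rewrite /= muln1 expr0 mul1r; left.
- move=> okf; rewrite (_ : len (Fside f) = (1 + len f)%N) // word_add [rank _]/= [word _ 1]/=.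
  have -> : word (fun i => quid e (Fside f) (1 + i)%N) (len f) = word (quid e f) (len f).
    by apply: eq_word => i _; rewrite /= muln0.
  rewrite -!mulrA [U (- _) * _]mulrA -UD addNr U0 mul1r exprSr -!mulrA.
  by rewrite muln1 addn0 [X in eqpm _ X]mulrA; apply: eqpmM (eqpm_refl _); apply: IH.
case/and3P=> h3 okc okf; rewrite [len _]/= [rank _]/= word_piece; last first.
  by have := dvd3_rank h3; have := rank_le_len okc; lia.
have Wc : eqpm (word (quid 1 c) (len c)) J.
  apply: eqpm_trans (IHc 1%N okc) _.
  have : eqpm ((U 1 * J) ^+ rank c * U 1 * J) 1.
    rewrite -mulrA -exprSr; case/dvdnP: h3 => k ->.
    by rewrite mulnC exprM U1J3 -signr_odd; case: odd; [right|left].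
  move/eqpmM/(_ (eqpm_refl (- J))); rewrite mul1r -mulrA mulrN JJ opprK mulr1.
  by move/eqpm_trans; apply; apply: eqpmN.
apply: eqpmM (eqpm_refl _).
apply: eqpm_trans (eqpmM (IHf e okf) Wc) _.
by rewrite exprSr !mulrA; left.
Qed.

Lemma M_forest f : is_3d f ->
  eqpm (M (map Posz (mkseq (quid 0 f) (len f).+1))) (J ^+ (rank f).+1).
Proof.
move=> okf; rewrite M_mkseq exprSr; apply: eqpmM (eqpm_refl _).
by have := word_forest 0 okf; rewrite U0 mul1r mulr1.
Qed.

(** * Solutions in positive integers *)

Definition Mnat (s : seq nat) := M (map Posz s).

Lemma Mnat_cat s t : Mnat (s ++ t) = Mnat t * Mnat s.
Proof. by rewrite /Mnat map_cat M_cat. Qed.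

Lemma Mnat_ear a b : Mnat [:: a.+1; 1; b.+1]%N = Mnat [:: a; b].
Proof. by rewrite /Mnat /= !M_cons M_nil !mul1r !mx2M; congr mx2; lia. Qed.

Lemma Mnat_triple a b : Mnat [:: a; 1; 1; b.+1]%N = - Mnat [:: a + b]%N.
Proof.
by rewrite /Mnat /= !M_cons M_nil !mul1r !mx2M mx2N; congr mx2; lia.
Qed.

(** The new upper left entry [x p - r] is at least [2 p - r], hence exceeds [p], which becomes the
    new lower left entry. *)
Lemma Mnat_ge2 s : all (leq 2) s -> exists p q r t,
  Mnat s = mx2 p q r t /\ [/\ (size s)%:Z < p, 0 <= r & r < p].
Proof.
elim/last_ind: s => [_|s x IH]; first by exists 1, 0, 0, 1; rewrite /Mnat M_nil mx2_1.
rewrite all_rcons => /andP[x2 /IH[p [q [r [t [E [sp r0 rp]]]]]]].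
exists (x%:Z * p - r), (x%:Z * q - t), p, q; split.
  by rewrite /Mnat map_rcons M_rcons [M _]E mx2M; congr mx2; ring.
have : 2 * p <= x%:Z * p by rewrite ler_pM2r; lia.
by rewrite size_rcons; split; lia.
Qed.

Definition has_ear s := exists u v a b,
  [/\ (0 < a)%N, (0 < b)%N & s = u ++ [:: a.+1; 1; b.+1]%N ++ v].

Definition has_triple s := exists u v a b,
  [/\ (0 < a)%N & s = u ++ [:: a; 1; 1; b.+1]%N ++ v].

Lemma has_ear_cons x s : has_ear s -> has_ear (x :: s).
Proof. by case=> u [v [a [b [a0 b0 ->]]]]; exists (x :: u), v, a, b. Qed.

Lemma has_triple_cons x s : has_triple s -> has_triple (x :: s).
Proof. by case=> u [v [a [b [a0 ->]]]]; exists (x :: u), v, a, b. Qed.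

(** Without reducible patterns, an entry 1 occurs only at an end or next to an end entry 1. The
    induction adds an entry [x] in front of a tail already of this shape. *)
Lemma irreducible_shape s : all (leq 1) s -> (1 < size s)%N ->
  [\/ has_ear s, has_triple s | exists x y mid, [/\ (0 < x)%N, (0 < y)%N, all (leq 2) mid &
     [\/ s = x :: rcons mid y, s = [:: 1; 1]%N ++ rcons mid y, s = x :: mid ++ [:: 1; 1]%N
       | s = [:: 1; 1]%N ++ mid ++ [:: 1; 1]%N]]].
Proof.
elim: s => // x [//|x' s] IH /= /andP[x0 /andP[x'0 s0]] _.
case: s IH s0 => [|z s] IH s0.
  by constructor 3; exists x, x', [::]; split => //; constructor 1.
have [|//|/has_ear_cons|/has_triple_cons|] := IH; first by rewrite /= x'0.
- by constructor 1.
- by constructor 2.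
case=> a [y [mid [a0 y0 mid2 H]]].
have [x'2|] := boolP (1 < x')%N.
  constructor 3; exists x, y, (x' :: mid); split; rewrite //= ?x'2 //.
  case: H => [[-> ->]|[] x'1|[-> ->]|[] x'1]; [constructor 1|lia|constructor 3|lia] => //.
rewrite -leqNgt => x'1; have {x'0 x'1} x'1 : x' = 1%N by lia.
subst x'.
(* The list is now [x, 1, z, ...]. For [z = 1] it starts with a triple unless it ends there; for
   [x = 1] it starts with [1, 1]; otherwise it starts with an ear. *)
have [z1|z1] := eqVneq z 1%N.
  subst z; case: s IH s0 H => [|w s] _ /= s0 H.
    by constructor 3; exists x, 1%N, [::]; split=> //; constructor 3.
  constructor 2; exists [::], s, x, w.-1; split=> //=.
  by rewrite prednK //; case/andP: s0.
have [x1|x1] := eqVneq x 1%N.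
  subst x.
  case: H => [[_ E]|[zz _]|[_ E]|[zz _]]; try by rewrite zz eqxx in z1.
    by constructor 3; exists 1%N, y, mid; split=> //; constructor 2; rewrite E.
  by constructor 3; exists 1%N, y, mid; split=> //; constructor 4; rewrite E.
constructor 1; exists [::], s, x.-1, z.-1; case/andP: s0 => z0 _.
by split; rewrite ?prednK //=; lia.
Qed.

Lemma eqpm_mx2 a b c d a' b' c' d' : eqpm (mx2 a b c d) (mx2 a' b' c' d') ->
  [/\ a = a', b = b', c = c' & d = d'] \/ [/\ a = - a', b = - b', c = - c' & d = - d'].
Proof. by case=> [/mx2_inj|]; [left|rewrite mx2N => /mx2_inj; right]. Qed.

(** The matrix equation either is contradictory or forces [p = 1], or [p = 2] and [r = 1], for the
    middle block. Since [p] exceeds the length of [mid], this block is then empty or the single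
    entry 2. *)
Lemma irreducible_cases x y mid s : (0 < x)%N -> (0 < y)%N -> all (leq 2) mid ->
  [\/ s = x :: rcons mid y, s = [:: 1; 1]%N ++ rcons mid y, s = x :: mid ++ [:: 1; 1]%N
       | s = [:: 1; 1]%N ++ mid ++ [:: 1; 1]%N] ->
  (eqpm (Mnat s) 1 -> s = [:: 1; 1; 1]%N) /\ (eqpm (Mnat s) J -> s = [:: 1; 1; 2; 1; 1]%N).
Proof.
move=> x0 y0 mid2 H; have [p [q [r [t [E [sp r0 rp]]]]]] := Mnat_ge2 mid2.
have mid0 : p = 1 -> mid = [::] /\ [/\ q = 0, r = 0 & t = 1].
  move=> p1; have m0 : mid = [::] by apply: size0nil; lia.
  by rewrite m0 /Mnat M_nil -mx2_1 in E; case/mx2_inj: E.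
have mid1 : p = 2 -> r = 1 -> mid = [:: 2]%N.
  move=> p2 r1; case: mid E sp {H mid2 mid0} => [|z [|w mid]] /= E sp; last by lia.
    by rewrite /Mnat M_nil -mx2_1 in E; case/mx2_inj: E; lia.
  by rewrite /Mnat M_seq1 in E; case/mx2_inj: E => *; congr [:: _]; lia.
have yp : p <= y%:Z * p by rewrite ler_peMl; lia.
have {}H : [\/ s = [:: x] ++ mid ++ [:: y], s = [:: 1; 1]%N ++ mid ++ [:: y],
    s = [:: x] ++ mid ++ [:: 1; 1]%N | s = [:: 1; 1]%N ++ mid ++ [:: 1; 1]%N].
  by rewrite !cats1.
rewrite -mx2_1; case: H => ->; rewrite !Mnat_cat E /Mnat /= !M_cons !M_nil !mul1r !mx2M;
  split => /eqpm_mx2 H.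
- by case: H => -[]; lia.
- by case: H => -[]; lia.
- have [m0 [q0 _ t1]] : mid = [::] /\ [/\ q = 0, r = 0 & t = 1] by apply: mid0; case: H => -[]; lia.
  have -> : y = 1%N by subst; case: H => -[]; lia.
  by rewrite m0.
- have [m0 [q0 _ t1]] : mid = [::] /\ [/\ q = 0, r = 0 & t = 1] by apply: mid0; case: H => -[]; lia.
  by subst; case: H => -[]; lia.
- have [m0 [q0 rr t1]] : mid = [::] /\ [/\ q = 0, r = 0 & t = 1] by apply: mid0;
  case: H => -[]; lia.
  have -> : x = 1%N by subst; case: H => -[]; lia.
  by rewrite m0.
- by case: H => -[]; lia.
- by case: H => -[]; lia.
by rewrite mid1 //; case: H => -[]; lia.
Qed.

Lemma nth_mkseq_cat (g : nat -> nat) n u w v :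
  u ++ w ++ v = mkseq g n ->
  [/\ size u + size w + size v = n,
     forall i, i < size u -> nth 0 u i = g i,
     forall i, i < size w -> nth 0 w i = g (size u + i) &
     forall i, i < size v -> nth 0 v i = g (size u + size w + i)]%N.
Proof.
move=> E; have sz : (size u + size w + size v = n)%N.
  by rewrite -(size_mkseq g n) -E !size_cat addnA.
have nE i : (i < n)%N -> nth 0%N (u ++ w ++ v) i = g i by move=> h; rewrite E nth_mkseq.
split=> // i lt_i.
- by rewrite -nE ?nth_cat ?lt_i //; lia.
- rewrite -nE; last by lia.
  by rewrite nth_cat ltnNge leq_addr /= addKn nth_cat lt_i.
- rewrite -nE; last by lia.
  by rewrite catA nth_cat size_cat ltnNge leq_addr /= addKn.
Qed.

Lemma mkseq_catP (g : nat -> nat) n u w v :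
  [/\ size u + size w + size v = n,
     forall i, i < size u -> nth 0 u i = g i,
     forall i, i < size w -> nth 0 w i = g (size u + i) &
     forall i, i < size v -> nth 0 v i = g (size u + size w + i)]%N ->
  u ++ w ++ v = mkseq g n.
Proof.
case=> sz hu hw hv; apply: (@eq_from_nth _ 0%N) => [|i]; rewrite ?size_mkseq !size_cat.
  by rewrite addnA.
move=> lt_i; rewrite nth_mkseq; last by lia.
rewrite !nth_cat; case: ltnP => [/hu//|le1]; case: ltnP => [/hw ->|le2]; first by congr g; lia.
by rewrite hv; [congr g; lia|lia].
Qed.

Lemma J_sqr : J ^+ 2 = -1. Proof. by rewrite expr2 JJ. Qed.

Lemma J_cube : J ^+ 3 = - J. Proof. by rewrite exprS J_sqr mulrN mulr1. Qed.

(** Converse of [M_forest] for ranks 1 and 2, by induction on the length: shorten the word, take the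
    forest of the result, and undo the move on it. *)
Lemma forest_of_word r s : (r == 1)%N || (r == 2)%N -> all (leq 1) s -> s != [::] ->
  eqpm (Mnat s) (J ^+ r.+1) ->
  exists f, [/\ is_3d f, rank f = r & s = mkseq (quid 0 f) (len f).+1].
Proof.
move=> r12; have [m] := ubnP (size s); elim: m s => // m IH s /ltnSE le_sm s1 s0 Ms.
have [gt1|] := ltnP 1 (size s); last first.
  case: s s1 s0 Ms {le_sm} => // x [|//] /= /andP[x0 _] _; rewrite /Mnat M_seq1 => Ms.
  case/orP: r12 Ms => /eqP ->; rewrite ?J_sqr ?J_cube => Ms.
    by move/eqpm_trans/(_ (eqpmN _)): Ms; rewrite -mx2_1 => /eqpm_mx2 [] [].
  by move/eqpm_trans/(_ (eqpmN _)): Ms => /eqpm_mx2 [] []; lia.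
case: (irreducible_shape s1 gt1).
- case=> u [v [a [b [a0 b0 sE]]]].
  have [||||f [okf rf]] := IH (u ++ [:: a; b] ++ v).
  + by move: le_sm; rewrite sE !size_cat /=; lia.
  + by move: s1; rewrite sE !all_cat /= a0 b0.
  + by case: (u).
  + by move: Ms; rewrite sE !Mnat_cat Mnat_ear.
  move/nth_mkseq_cat => [/= sz hu hw hv].
  have [|f' [ok' len' rk'] q'] := @ear_insertion f 0 (size u) okf; first by lia.
  exists f'; split => //; first by rewrite rk'.
  rewrite sE; apply: mkseq_catP; split => /=.
  + by rewrite len'; lia.
  + by move=> i lt_i; rewrite hu // q' ltnW // ltn_eqF // addn0.
  + move: (hw 0%N isT) (hw 1%N isT); rewrite addn0 addn1 => /= aE bE.
    case=> [|[|[|//]]] _ /=; rewrite q' ?addn0 ?addn1 ?addn2 ?leqnn ?eqxx /=; first by lia.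
      by rewrite ltnn.
    by rewrite !ifF -?bE ?addn1 //; lia.
  + by move=> i lt_i; rewrite hv // q' !ifF; [rewrite (_ : _ == _ = false); [rewrite addn0;
    congr quid|]|..]; lia.
- case=> u [v [a [b [a0 sE]]]].
  have [||||f [okf rf]] := IH (u ++ [:: a + b]%N ++ v).
  + by move: le_sm; rewrite sE !size_cat /=; lia.
  + by move: s1; rewrite sE !all_cat /= addn_gt0 a0.
  + by case: (u).
  + move: Ms; rewrite sE !Mnat_cat Mnat_triple mulrN mulNr => /(eqpm_trans (eqpm_sym (eqpmN _))).
    by [].
  move/nth_mkseq_cat => [/= sz hu hw hv].
  move: (hw 0%N isT); rewrite addn0 /= => abE.
  have [|||||f' [ok' len' rk'] [lo [q0 q1 q2 q3] hi]] :=
     @triple_insertion f 0 (size u) a b.+1 okf; [by lia..|].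
  (* With [e = 0] the enclosing piece is never the one enlarged, so the rank is kept. *)
  exists f'; split => //; first by case: rk' => [|[]//]; rewrite rf.
  rewrite sE; apply: mkseq_catP; split => /=.
  + by rewrite len'; lia.
  + by move=> i lt_i; rewrite hu // lo.
  + by case=> [|[|[|[|//]]]] _ /=; rewrite ?addn0 ?addn1 ?addn2 ?addn3.
  + move=> i lt_i; rewrite hv // -hi; last by lia.
    by congr quid; lia.
case=> x [y [mid [x0 y0 mid2 H]]]; have [H1 H2] := irreducible_cases x0 y0 mid2 H.
case/orP: r12 Ms => /eqP ->.
  rewrite J_sqr => /eqpm_trans/(_ (eqpmN _))/H1 ->.
  (* The word [1, 1, 1] is a triangle; below, [1, 1, 2, 1, 1] is two triangles with a common
     vertex. *)
  by exists (Fpiece (Fside (Fside Fnil)) Fnil).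
rewrite J_cube => /eqpm_trans/(_ (eqpmN _))/H2 ->.
by exists (Fpiece (Fside (Fside Fnil)) (Fpiece (Fside (Fside Fnil)) Fnil)).
Qed.

(** * Notched and capped dissections *)

Lemma M_rcons1 s : eqpm (M (rcons s 1)) T <-> eqpm (M s) J.
Proof.
have SJ : mx2 1 (-1) 1 0 * J = - T by rewrite mx2M mx2N; congr mx2; ring.
rewrite M_rcons; split=> [H|/(eqpmM (eqpm_refl (mx2 1 (-1) 1 0)))].
  (* This matrix is the inverse of the factor of the entry 1. *)
  have := eqpmM (eqpm_refl (mx2 0 1 (-1) 1)) H; rewrite mulrA !mx2M /J.
  have -> : mx2 (0 * 1 + 1 * 1) (0 * -1 + 1 * 0) (-1 * 1 + 1 * 1) (-1 * -1 + 1 * 0) = 1.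
    by rewrite -mx2_1; congr mx2; ring.
  rewrite mul1r => /eqpm_trans; apply; right; rewrite mx2N; congr mx2; ring.
by move/eqpm_trans; apply; rewrite SJ; exact: eqpmN.
Qed.

(** Raising the last entry by one multiplies the product by [T] on the left, and [T] can be
    cancelled. *)
Lemma M_last_succ h k :
  eqpm (M (map Posz (mkseq (fun i => h i + (i == k))%N k.+1))) T <->
  eqpm (M (map Posz (mkseq h k.+1))) 1.
Proof.
have -> : mkseq (fun i => h i + (i == k))%N k.+1 = rcons (mkseq h k) (h k).+1.
  rewrite mkseqS eqxx addn1; congr rcons; apply/eq_in_map => i.
  by rewrite mem_iota => /andP[_ ik]; rewrite ltn_eqF ?addn0.
rewrite mkseqS !map_rcons !M_rcons.
have -> : mx2 (h k).+1 (-1) 1 0 = T * mx2 (h k) (-1) 1 0.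
  by rewrite mx2M; congr mx2; lia.
rewrite -mulrA; set A := _ * M _; split=> H; last first.
  by have := eqpmM (eqpm_refl T) H; rewrite mulr1.
have := eqpmM (eqpm_refl (U (-1))) H.
have UT : U (-1) * T = 1 by rewrite -U0 (_ : 0 = -1 + 1) ?UD.
by rewrite mulrA UT mul1r.
Qed.

Lemma card_count (I : finType) (A : {set I}) (s : seq I) (P : pred I) :
  A =i s -> uniq s -> #|[set x in A | P x]| = count P s.
Proof.
move=> As us; rewrite -size_filter -(card_uniqP (filter_uniq _ us)).
by apply: eq_card => x; rewrite inE mem_filter As andbC.
Qed.

Lemma sum_count (I : finType) (A : {set I}) (Delta : I) (s : seq I) (P : pred I) :
  A =i Delta :: s -> uniq (Delta :: s) ->
  \sum_(x in A | P x) (if x == Delta then -1 else 1 : int) = (count P s)%:Z - (P Delta)%:Z.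
Proof.
move=> As us; rewrite big_mkcondr (eq_bigl _ _ As) -big_uniq // big_cons eqxx.
case/andP: us => Ds us; rewrite [RHS]addrC; congr (_ + _); first by case: (P _).
elim: s Ds {As us} => [|y s IH]; first by rewrite big_nil.
rewrite inE negb_or big_cons /= eq_sym => /andP[/negbTE -> /IH ->].
by rewrite PoszD; case: (P y).
Qed.

(** * Notched dissections and forests of rank 2 *)

Section Notched.
Variables (f : forest) (m : nat) (D : {set {set 'I_m.+1}}).
Hypotheses (okf : is_3d f) (rf : rank f = 2) (lf : (len f).+1 = m).
Hypothesis sD : subpolygons D =i top_set m.+1 0 (Fside f) :: pieces m.+1 0 (Fside f).

Let g := Fside f.

Let wfg : wf g. Proof. exact: (is_3d_wf okf). Qed.

Let lg : (0 + len g < m.+1)%N. Proof. by rewrite /=; lia. Qed.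

Let uniq_g : uniq (top_set m.+1 0 g :: pieces m.+1 0 g).
Proof. by apply: all_pieces_uniq => //=; rewrite ?rf //; lia. Qed.

Let pieces_g3 F : F \in pieces m.+1 0 g -> (3 %| #|F|)%N.
Proof. by apply/allP: F; rewrite (pieces_dvd3 wfg lg). Qed.

Let card_vset_g : #|top_set m.+1 0 g| = 4%N.
Proof. by rewrite card_top_set //= rf. Qed.

(** The enclosing piece is the quadrilateral, whose 4 vertices keep it out of the count: hence
    [e = 0]. The bare side in front of [f] shifts the vertices by one. *)
Lemma notched_quiddityE : notched_quiddity D = [tuple (quid 0 f i)%:Z | i < m].
Proof.
apply: eq_from_tnth => i; rewrite !tnth_mktuple; congr Posz.
rewrite (card_count _ sD uniq_g) /= card_vset_g /= add0n.
transitivity (quid 0 g (lift ord0 i - 0)%N); last by rewrite subn0 lift0.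
rewrite (quid_count _ wfg lg) // add0n; apply: eq_in_count => F FP /=.
by rewrite pieces_g3.
Qed.

End Notched.

Lemma notched_of_forest f m (lf : (len f).+1 = m) : is_3d f -> rank f = 2 ->
  (0 < quid 0 f 0)%N -> (0 < quid 0 f (len f))%N ->
  is_notched_quiddity [tuple (quid 0 f i)%:Z | i < m].
Proof.
move=> okf rf q0 qlast.
(* A bare side at either end of [f] would make the corresponding end entry 0. So the two sides of
   the quadrilateral away from 0 are diagonals. *)
have [c [c' fE]] : exists c c', f = Fpiece c (Fpiece c' Fnil).
  case: f {lf} okf rf q0 qlast => [//|f //|c f1] /and3P[h3 okc _] [].
  case: f1 => [//|f|c' f] /= [] r0 _; last by case: f r0 => // _ _; exists c, c'.
  have lc : (0 < len c)%N by have := dvd3_rank h3; have := rank_le_len okc; lia.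
  case: f r0 => // _ /=; rewrite leq_addr addKn quid_out ?addn1 //.
rewrite fE /= in lf okf; case/and3P: (okf) => h3 okc /and3P[h3' okc' _].
have := dvd3_rank h3; have := rank_le_len okc; have := dvd3_rank h3'; have := rank_le_len okc'.
move=> lc' rc' lc rc; have wfg : wf (Fside f) by rewrite fE;
  apply: (@is_3d_wf (Fside (Fpiece c (Fpiece c' Fnil)))).
have rg : (1 < rank (Fside f))%N by rewrite /= rf.
have lg : (len (Fside f)).+1 = m.+1 by rewrite fE /=; lia.
have lgN : (0 + len (Fside f) < m.+1)%N by lia.
have [dD cp nc] := forest_dissectionP wfg rg lg.
set D := forest_dissection _ _ in dD cp nc; set Q := top_set m.+1 0 (Fside f).
have sD := subpolygons_forest dD wfg rg lg cp nc.
have cQ : #|Q| = 4%N by rewrite card_top_set //= rf.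
have ug := all_pieces_uniq wfg rg lgN.
have p3 F : F \in pieces m.+1 0 (Fside f) -> (3 %| #|F|)%N.
  by apply/allP: F; rewrite (pieces_dvd3 wfg lgN) fE.
have m1 : (1 < m.+1)%N by lia.
pose o1 := Ordinal m1.
have inQ (x : 'I_m.+1) : (x \in Q) = (nat_of_ord x \in [:: 0; 1; (len c).+1; m])%N.
  by rewrite in_top_set fE /= (_ : 1 + len c + len c' = m)%N ?add1n //; lia.
have l1 : ((ord0 : 'I_m.+1) < o1)%N by [].
have lm : ((ord0 : 'I_m.+1) < (ord_max : 'I_m.+1))%N by rewrite /=; lia.
have BE : sides Q :&: sides [set: 'I_m.+1] = [set [set ord0; o1]; [set ord0; ord_max]].
  apply/setP => e; rewrite inE; apply/andP/set2P => [[eQ eP]|].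
    have [x [y [xy E]]] := sides_pair eQ; subst e.
    move: eP; rewrite sides_setT //=.
    have /(sidesP _ xy)[] := eQ; rewrite !inQ !inE => xQ yQ _ h.
    have [x0 [y1|ym]] : x = 0%N :> nat /\ (y = 1%N :> nat \/ y = m :> nat) by lia.
      by left; congr [set _; _]; apply: val_inj.
    by right; congr [set _; _]; apply: val_inj.
  case=> ->; rewrite sides_setT //= ?eqxx ?orbT; split=> //; apply/sidesP => //.
    split; rewrite ?inQ ?inE //=; left=> w _; lia.
  by split; rewrite ?inQ ?inE //= ?eqxx ?orbT //; right=> w _; have := ltn_ord w; lia.
exists D, Q; split; last by rewrite (notched_quiddityE _ rf _ sD) // fE.
split=> //; first by lia.
- apply/setP => F; rewrite in_set sD in_cons in_set1.
  have [->|ne] := eqVneq F Q; first by rewrite cQ eqxx.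
  by apply/negbTE/negP => /andP[/p3 d3 /eqP c4]; rewrite c4 in d3.
- by move=> F; rewrite sD in_cons => /orP[/eqP ->|/p3 //]; rewrite eqxx.
- rewrite BE cards2; case: eqP => // E.
  have : o1 \in [set ord0; ord_max] by rewrite -E set22.
  by case/set2P => /(congr1 val) /=; lia.
by move=> e; rewrite BE => /set2P[->|->]; rewrite set21.
Qed.

Lemma forest_of_notched m (a : m.-tuple int) : is_notched_quiddity a ->
  exists f, [/\ is_3d f, rank f = 2, (len f).+1 = m & a = [tuple (quid 0 f i)%:Z | i < m]].
Proof.
case=> D [Q [[m5 dD Qq Qo Qs Q0] ->]].
have [|g [wfg lg rg cp nc]] := @exists_forest _ D 0 m dD _ (ltnSn m); first by lia.
rewrite add0n in lg.
have lgN : (0 + len g < m.+1)%N by lia.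
have lgN' : (len g).+1 = m.+1 by rewrite lg.
have sD := subpolygons_forest dD wfg rg lgN' cp nc.
have m1 : (1 < m.+1)%N by lia.
pose o1 := Ordinal m1.
have l1 : ((ord0 : 'I_m.+1) < o1)%N by [].
have lm : ((ord0 : 'I_m.+1) < (ord_max : 'I_m.+1))%N by rewrite /=; lia.
(* Only these two sides of the polygon contain the vertex 0, and [Q] has two such sides. *)
have BE : sides Q :&: sides [set: 'I_m.+1] = [set [set ord0; o1]; [set ord0; ord_max]].
  apply/eqP; rewrite eqEcard Qs cards2; apply/andP; split; last by case: (_ != _).
  apply/subsetP => e eB; have e0 := Q0 e eB.
  have [x [y [xy E]]] : exists x y : 'I_m.+1, (x < y)%N /\ e = [set x; y].
    by case/setIP: eB => /sides_pair.
  subst e; case/setIP: eB => _; rewrite sides_setT //= => h.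
  have x0 : x = 0%N :> nat by case/set2P: e0 => E; move: xy; rewrite -E.
  have [y1|ym] : y = 1%N :> nat \/ y = m :> nat by lia.
    by apply/set2P; left; congr [set _; _]; apply: val_inj.
  by apply/set2P; right; congr [set _; _]; apply: val_inj.
have /setIP[/(sidesP _ l1)[Q0' Q1 _] _] : [set ord0; o1] \in sides Q :&: sides [set: 'I_m.+1].
  by rewrite BE set21.
have /setIP[/(sidesP _ lm)[_ Qm _] _] : [set ord0; ord_max] \in sides Q :&: sides [set: 'I_m.+1].
  by rewrite BE set22.
have : Q \in [set F in subpolygons D | #|F| == 4%N] by rewrite Qq set11.
rewrite inE => /andP[QD /eqP cQ].
(* As [Q] contains both 0 and [m], it is within no member of the row. *)
have QE : Q = top_set m.+1 0 g.
  move: QD; rewrite sD in_cons => /orP[/eqP //|/(pieces_within wfg)[//|]].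
  by rewrite (@not_within _ _ _ _ ord0 ord_max) //= lg.
have rg3 : rank g = 3 by have := card_top_set wfg lgN; rewrite -QE cQ => -[].
(* A piece as first member would keep the vertex 1 off the quadrilateral. *)
have [f gE] : exists f, g = Fside f.
  case: (g) wfg rg3 QE => [//|f _ _ _|c f]; first by exists f.
  case/and3P=> rc /wf_rank_le_len lc _ _ QE.
  by move: Q1; rewrite QE in_top_set /= inE /= => /top_bounds; lia.
subst g; case: rg3 => rf.
have ug := all_pieces_uniq wfg rg lgN.
have okf : is_3d f.
  rewrite -[is_3d f]/(is_3d (Fside f)) -(pieces_dvd3 wfg lgN); apply/allP => F FP.
  apply: Qo; first by rewrite sD in_cons FP orbT.
  by apply: contraTneq ug => FQ; rewrite cons_uniq -QE -FQ FP.
exists f; split=> //.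
by rewrite (notched_quiddityE okf rf _ sD).
Qed.

(** * Capped dissections and forests with a single member *)

(* The vertex 0 followed by Delta, with base (0, n + 1); then Delta', with base
   (1, n + 1), which carries the polygon on 1, ..., n. *)
Definition capped_forest c := Fside (Fpiece (Fpiece c (Fside Fnil)) Fnil).

(** At vertex 1 the weights of the two triangles cancel; at vertex [n] only [Delta'] counts, which
    raises the last entry by one. *)
Lemma capped_quiddityE n c (D : {set {set 'I_n.+2}}) :
  is_3d (Fpiece c Fnil) -> (len c).+1 = n ->
  subpolygons D =i top_set n.+2 0 (capped_forest c) :: pieces n.+2 0 (capped_forest c) ->
  capped_quiddity D (top_set n.+2 0 (capped_forest c)) =
  [tuple (quid 0 (Fpiece c Fnil) i + (i == n.-1 :> nat))%:Z | i < n].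
Proof.
move=> okf lc sD; have /and3P[h3 okc _] := okf.
have okg : is_3d (capped_forest c) by apply/and3P.
have wfg := is_3d_wf okg.
have lgN : (0 + len (capped_forest c) < n.+2)%N by rewrite /=; lia.
have ug := all_pieces_uniq wfg isT lgN.
apply: eq_from_tnth => i; rewrite !tnth_mktuple /capped_weight.
rewrite (sum_count _ sD ug).
have xi : (inord i.+1 : 'I_n.+2) = i.+1 :> nat by rewrite inordK //; have := ltn_ord i; lia.
have := quid_count 0 wfg lgN (leq0n (inord i.+1 : 'I_n.+2)); rewrite mul0n add0n => <-.
have lc0 : (0 < len c)%N by have := dvd3_rank h3; have := rank_le_len okc; lia.
have i_n := ltn_ord i.
rewrite subn0 xi in_top_set xi /= !inE !mul0n !mul1n if_same !add0n.
have [le|lt] := leqP (len c) i; last by rewrite !addn0; lia.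
by have -> : nat_of_ord i = len c; [lia|rewrite subnn; lia].
Qed.

Lemma capped_of_forest c n : is_3d (Fpiece c Fnil) -> (len c).+1 = n ->
  is_capped_quiddity [tuple (quid 0 (Fpiece c Fnil) i + (i == n.-1 :> nat))%:Z | i < n].
Proof.
move=> okf lc; have /and3P[h3 okc _] := okf.
have lc' := rank_le_len okc; have rc := dvd3_rank h3.
have okg : is_3d (capped_forest c) by apply/and3P.
have wfg := is_3d_wf okg; have rg : (1 < rank (capped_forest c))%N by [].
pose c1 := Fpiece c (Fside Fnil).
have wfc1 : wf c1 by case/and3P: wfg.
have lg : (len (capped_forest c)).+1 = n.+2 by rewrite /=; lia.
have lgN : (0 + len (capped_forest c) < n.+2)%N by lia.
have [dD cp nc] := forest_dissectionP wfg rg lg.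
set D := forest_dissection _ _ in dD cp nc; set A := top_set n.+2 0 (capped_forest c);
  set B := top_set n.+2 1 c1.
have sD := subpolygons_forest dD wfg rg lg cp nc.
have ug := all_pieces_uniq wfg rg lgN.
have AD : A \in subpolygons D by rewrite sD in_cons eqxx.
have BD : B \in subpolygons D by rewrite sD !in_cons eqxx orbT.
have cA : #|A| = 3%N by rewrite card_top_set.
have cB : #|B| = 3%N by rewrite card_top_set //=; lia.
have n1 : (1 < n.+2)%N by [].
have nn : (n < n.+2)%N by [].
pose o1 := Ordinal n1; pose on := Ordinal nn.
have inA (x : 'I_n.+2) : (x \in A) = (nat_of_ord x \in [:: 0; 1; n.+1])%N.
  by rewrite in_top_set /= (_ : 1 + (len c + 1) = n.+1)%N //; lia.
have inB (x : 'I_n.+2) : (x \in B) = (nat_of_ord x \in [:: 1; n; n.+1])%N.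
  by rewrite in_top_set /= (_ : 1 + len c = n)%N //; lia.
have l01 : ((ord0 : 'I_n.+2) < o1)%N by [].
have l0m : ((ord0 : 'I_n.+2) < (ord_max : 'I_n.+2))%N by [].
have l1m : (o1 < (ord_max : 'I_n.+2))%N by rewrite /=; lia.
have lnm : (on < (ord_max : 'I_n.+2))%N by rewrite /=; lia.
have BE : sides A :&: sides [set: 'I_n.+2] = [set [set ord0; o1]; [set ord0; ord_max]].
  apply/setP => e; rewrite inE; apply/andP/set2P => [[eQ eP]|].
    have [x [y [xy E]]] := sides_pair eQ; subst e.
    move: eP; rewrite sides_setT //=.
    have /(sidesP _ xy)[] := eQ; rewrite !inA !inE => xQ yQ _ h.
    have [x0 [y1|ym]] : x = 0%N :> nat /\ (y = 1%N :> nat \/ y = n.+1 :> nat).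
      by clear -xQ yQ h xy lc lc' rc; lia.
      by left; congr [set _; _]; apply: val_inj.
    by right; congr [set _; _]; apply: val_inj.
  case=> ->; rewrite sides_setT //= ?eqxx ?orbT; split=> //; apply/sidesP => //.
    split; rewrite ?inA ?inE //=; left=> w _; lia.
  by split; rewrite ?inA ?inE //= ?eqxx ?orbT //; right=> w _; have := ltn_ord w; lia.
(* The pieces other than the two triangles avoid the vertices numbered 0 and -1. *)
have B_low F : F \in pieces n.+2 1 c -> forall x, x \in F -> (0 < x <= n)%N.
  case/pieces_within; [by case/and3P: wfc1|lia|].
  by move=> /within_inside/insideP H _ x /H; lia.
have vc_low x : x \in top_set n.+2 1 c -> (0 < x <= n)%N.
  by rewrite in_top_set => /top_bounds; lia.
have in_sub F : (F \in subpolygons D) = [|| F == A, F == B, F == top_set n.+2 1 c | F \in pieces n.+2 1 c].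
  by rewrite sD /= cats0 cats0 !in_cons.
exists D, A, B; split; last by rewrite capped_quiddityE.
split=> //.
- by clear -lc lc' rc; lia.
- move=> F; rewrite sD in_cons => /orP[/eqP ->|]; first by rewrite cA.
  by apply/allP: F; rewrite (pieces_dvd3 wfg lgN).
- rewrite BE cards2; case: eqP => // E.
  have : o1 \in [set ord0; ord_max] by rewrite -E set22.
  by case/set2P => /(congr1 val) /=; clear -lc lc' rc; lia.
- by apply/eqP => E; case/andP: ug; rewrite -/A -E in_cons eqxx.
- apply/set0Pn; exists [set o1; ord_max]; rewrite inE; apply/andP; split; apply/sidesP => //.
    by split; rewrite ?inA ?inE //= ?eqxx ?orbT //; left=> w; rewrite inA !inE;
      clear -lc lc' rc; lia.
  by split; rewrite ?inB ?inE //= ?eqxx ?orbT //; right=> w; rewrite inB !inE;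
    clear -lc lc' rc; lia.
- apply/set0Pn; exists [set on; ord_max]; apply/setIP; split; last by rewrite sides_setT //= eqxx.
  apply/sidesP => //.
  by split; rewrite ?inB ?inE //= ?eqxx ?orbT //; left=> w; rewrite inB !inE; clear -lc lc' rc; lia.
- apply/setP => F; rewrite in_set in_set1 in_sub.
  have [->|_] := eqVneq F A; first by rewrite inA.
  apply/negbTE/negP => /= /andP[/or3P[/eqP ->|/eqP ->|/B_low H] F0].
  + by move: F0; rewrite inB !inE /=; clear -lc lc' rc; lia.
  + by have := vc_low _ F0.
  by have := H _ F0.
apply/setP => F; rewrite in_set in_set2 in_sub.
have [->|_] := eqVneq F A; first by rewrite inA !inE /= eqxx !orbT.
have [->|_] := eqVneq F B; first by rewrite inB !inE /= eqxx !orbT.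
apply/negbTE/negP => /= /andP[/orP[/eqP ->|/B_low H] F0].
  by have := vc_low _ F0; rewrite /= ltnn.
by have := H _ F0; rewrite /= ltnn.
Qed.

Lemma forest_of_capped n (a : n.-tuple int) : is_capped_quiddity a ->
  exists c, [/\ is_3d (Fpiece c Fnil), (len c).+1 = n &
    a = [tuple (quid 0 (Fpiece c Fnil) i + (i == n.-1 :> nat))%:Z | i < n]].
Proof.
case=> D [A [B [[n3 dD d3 AD cA _ BD cB neB _ _ v0 vN] ->]]].
have [|g [wfg lg rg cp nc]] := @exists_forest _ D 0 n.+1 dD _ (ltnSn n.+1); first by lia.
rewrite add0n in lg.
have lgN : (0 + len g < n.+2)%N by lia.
have lgN' : (len g).+1 = n.+2 by rewrite lg.
have sD := subpolygons_forest dD wfg rg lgN' cp nc.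
have ug := all_pieces_uniq wfg rg lgN.
have only0 F : F \in top_set n.+2 0 g :: pieces n.+2 0 g -> ord0 \in F -> F = A.
  by move=> FD F0; apply/set1P; rewrite -v0 in_set sD FD.
have onlyN F : F \in top_set n.+2 0 g :: pieces n.+2 0 g -> ord_max \in F -> F = A \/ F = B.
  by move=> FD F0; apply/set2P; rewrite -vN in_set sD FD.
(* The enclosing piece contains 0, and only [Delta] does. *)
have AE : top_set n.+2 0 g = A.
  by apply: only0; rewrite ?in_cons ?eqxx // in_top_set top_first.
have rg2 : rank g = 2 by have := card_top_set wfg lgN; rewrite AE cA => -[].
have okg : is_3d g.
  rewrite -(pieces_dvd3 wfg lgN); apply/allP => F FP.
  by apply: d3; rewrite sD in_cons FP orbT.
rewrite -AE in neB only0 onlyN *.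
have notA F : F \in pieces n.+2 0 g -> F <> top_set n.+2 0 g.
  by move=> FP FA; move: ug; rewrite cons_uniq -{1}FA FP.
(* A piece as first member would also contain 0, and two bare sides would be too short for
   [n >= 3]. *)
have [c1 gE] : exists c1, g = Fside (Fpiece c1 Fnil).
  case: (g) rg2 lg wfg only0 notA => [//|[|f|c [|f|c' f]]|c f] //=.
  - by case: f => //= _; lia.
  - by move=> _ _ _ _ _; exists c.
  move=> _ _ _ only0 notA; case: (notA (top_set n.+2 0 c)); first by rewrite in_cons eqxx.
  by apply: only0; rewrite ?in_cons ?eqxx ?orbT // in_top_set top_first.
subst g; rewrite [len _]/= addn0 in lg; case/and3P: (wfg) => rc1 wfc1 _.
have c1N : ord_max \in top_set n.+2 1 c1.
  by rewrite in_top_set /= (_ : n.+1 = 1 + len c1)%N ?top_last; lia.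
have c1B : top_set n.+2 1 c1 = B.
  have c1P : top_set n.+2 1 c1 \in pieces n.+2 0 (Fside (Fpiece c1 Fnil)) by rewrite in_cons eqxx.
  have [||//] := onlyN _ _ c1N; first by rewrite in_cons c1P orbT.
  by move/(notA _ c1P).
have rc1' : rank c1 = 2.
  by apply: succn_inj; rewrite -(@card_top_set n.+2 1) ?c1B //; lia.
have notN F : F \in pieces n.+2 1 c1 -> ord_max \in F -> False.
  move=> FP FN; have FP' : F \in pieces n.+2 0 (Fside (Fpiece c1 Fnil)).
    by rewrite /= cats0 in_cons FP orbT.
  have [|/(notA _ FP') //|FB] := onlyN _ _ FN; first by rewrite in_cons FP' orbT.
  by move: ug; rewrite /= cats0 c1B -FB FP andbF.
(* A piece as last member of [c1] would be a third one at the vertex -1, and two bare sides would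
   again be too short. *)
have [c cE] : exists c, c1 = Fpiece c (Fside Fnil).
  case: c1 rc1' lg notN {rc1 wfc1 c1N c1B sD ug okg cp nc notA only0 onlyN wfg lgN lgN' rg rg2 AE neB} => [//|f|c f].
  - case: f => [//|[|f|c f]|c [|f|c' f]] //= _ lg notN; first by lia.
    case: (notN (top_set n.+2 2 c)); first by rewrite in_cons eqxx.
    by rewrite in_top_set /= (_ : n.+1 = 2 + len c)%N ?top_last; lia.
  case: f => [//|[|f|c' f]|c' [|f|c'' f]] //= _ lg notN; first by exists c.
  case: (notN (top_set n.+2 (1 + len c) c')); first by rewrite in_cons mem_cat in_cons eqxx !orbT.
  by rewrite in_top_set /= (_ : n.+1 = 1 + len c + len c')%N ?top_last; lia.
subst c1; have /and3P[_ okc _] := okg; have okf : is_3d (Fpiece c Fnil) := okc.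
have lc : (len c).+1 = n by rewrite [len _]/= in lg; clear -lg; lia.
by exists c; split=> //; rewrite capped_quiddityE.
Qed.

Lemma mktuple_Posz n (h : nat -> nat) :
  val [tuple (h i)%:Z | i < n] = map Posz (mkseq h n).
Proof. by rewrite /= /mkseq -map_comp -val_enum_ord -map_comp. Qed.

Lemma quiddity_unique n (a : n.-tuple int) (h : nat -> nat) :
  (forall i, (i < n)%N -> a`_i = h i) -> a = [tuple (h i)%:Z | i < n].
Proof. by move=> H; apply: eq_from_tnth => i; rewrite tnth_mktuple (tnth_nth 0) H. Qed.

Theorem mainTheorem2 (n : nat) (hn : (3 <= n)%N) :
  (forall a : (n.-1).-tuple int,
     (forall i : 'I_n.-1, 0 < tnth a i) ->
     (M (rcons a 1) = T \/ M (rcons a 1) = - T) <-> is_notched_quiddity a)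
  /\
  (forall a : n.-tuple int,
     (forall i : 'I_n, 0 < tnth a i) ->
     2 <= a`_n.-1 ->
     (M a = T \/ M a = - T) <-> is_capped_quiddity a).
Proof.
case: n hn => // n hn; rewrite /=.
have entry_gt0 k (a : k.-tuple int) : (forall i : 'I_k, 0 < tnth a i) ->
    forall i, (i < k)%N -> 0 < a`_i.
  by move=> a0 i lt_i; have := a0 (Ordinal lt_i); rewrite (tnth_nth 0).
have all1 (h : nat -> nat) k : (forall i, (i < k)%N -> (0 < h i)%N) -> all (leq 1) (mkseq h k).
  by move=> h0; apply/allP => x /mapP[i]; rewrite mem_iota => /andP[_ /h0 ? ->].
have nth_eq (h h' : nat -> nat) k : mkseq h k = mkseq h' k -> forall i, (i < k)%N -> h i = h' i.
  by move=> E i lt_i; rewrite -(nth_mkseq 0%N h lt_i) E nth_mkseq.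
split=> a /entry_gt0 a0.
  rewrite -/(eqpm (M (rcons a 1)) T) M_rcons1; split=> [Ma|/forest_of_notched[f [okf rf lf ->]]].
    pose h i := absz a`_i.
    have aE : a = [tuple (h i)%:Z | i < n] by apply: quiddity_unique => i /a0; rewrite /h; lia.
    have h0 i : (i < n)%N -> (0 < h i)%N by move/a0; rewrite /h; lia.
    rewrite aE mktuple_Posz in Ma.
    have [|||f [okf rf E]] := @forest_of_word 2 (mkseq h n) isT.
    - exact: all1.
    - by case: (n) hn.
    - by rewrite J_cube; apply: eqpm_trans Ma _; apply/eqpm_sym/eqpmN.
    have lf : (len f).+1 = n by rewrite -(size_mkseq h n) E size_mkseq.
    rewrite lf in E; have hE := nth_eq _ _ _ E.
    have -> : a = [tuple (quid 0 f i)%:Z | i < n].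
      by rewrite aE; apply: eq_from_tnth => i; rewrite !tnth_mktuple hE.
    (* Positivity of the end entries excludes bare sides at the ends of [f]. *)
    by apply: notched_of_forest => //; rewrite -hE ?h0 //; lia.
  rewrite mktuple_Posz -lf; apply: eqpm_trans (M_forest okf) _.
  by rewrite rf J_cube; exact: eqpmN.
move=> an; rewrite -/(eqpm (M a) T); split=> [Ma|/forest_of_capped[c [okf lc ->]]].
  (* The last entry, now of index [n], is lowered by one; it stays positive because it was at least
     2. *)
  pose h i := (absz (a`_i)%R - (i == n))%N.
  have hE i : (i < n.+1)%N -> a`_i = (h i + (i == n))%N%:Z.
    by rewrite /h => /a0; case: eqP => [->|_]; lia.
  have h0 i : (i < n.+1)%N -> (0 < h i)%N.
    move=> lt_i; rewrite /h; case: eqP => [->|_].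
      rewrite subn1; clear -an; by move: an; move: (a`_n) => z; lia.
    by have := a0 i lt_i; clear; lia.
  have aE := quiddity_unique hE.
  rewrite aE (mktuple_Posz _ (fun i => h i + (i == n))%N) M_last_succ in Ma.
  have [|||f [okf rf E]] := @forest_of_word 1 (mkseq h n.+1) isT.
  - exact: all1.
  - by [].
  - by rewrite J_sqr; apply: eqpm_trans Ma _; apply/eqpm_sym/eqpmN.
  have lf : (len f).+1 = n.+1 by rewrite -(size_mkseq h n.+1) E size_mkseq.
  rewrite lf in E; have hq := nth_eq _ _ _ E.
  (* The only other forest of rank 1 is a bare side, whose entries are 0. *)
  have [c fE] : exists c, f = Fpiece c Fnil.
    have := h0 0%N isT; rewrite hq //.
    by case: (f) rf => [//|//|c f' /= [r0] _]; exists c; case: f' r0.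
  rewrite aE; have -> : [tuple (h i + (i == n :> nat))%:Z | i < n.+1] =
      [tuple (quid 0 (Fpiece c Fnil) i + (i == n.+1.-1 :> nat))%:Z | i < n.+1].
    by apply: eq_from_tnth => i; rewrite !tnth_mktuple hq // fE.
  apply: capped_of_forest; rewrite -?fE //.
  by rewrite -lf fE /= addn0.
rewrite (mktuple_Posz _ (fun i => quid 0 (Fpiece c Fnil) i + (i == n))%N) M_last_succ -lc.
have := M_forest okf; rewrite J_sqr [len _]/= addn0 => /eqpm_trans; apply.
exact: eqpmN.
Qed.
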